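(* Let $G$ be a $\tau$-group of nilpotency class $c$ such that $\Gamma_c(G)$ has rank at least $2$. Then no Jennings embedding of $G$ into a unitriangular group $UT_d(\mathbb{Z})$ (for any choice of Mal'cev basis and any ordering of the basis of $\mathfrak{R}G/I^{c+1}$ making the representation unitriangular) has undistorted image.
   Context: A $\tau$-group is a finitely generated torsion-free non-abelian nilpotent group; $\Gamma_1(G)=G$, $\Gamma_{i+1}(G)=[\Gamma_i(G),G]$, and the class $c$ is the least $c$ with $\Gamma_{c+1}(G)=1$; the rank of the free abelian group $\Gamma_c(G)$ is its number of free generators. $\tau_i(G)$ is the isolator $\{g: g^k\in\Gamma_i(G)\text{ for some }k\ge1\}$. Jennings embedding: let $n=c+1$, $\mathfrak{R}$ a field of characteristic $0$, $I$ the augmentation ideal of $\mathfrak{R}G$. Refine $G=\tau_1(G)>\dots>\tau_n(G)=1$ to a series with infinite cyclic factors $G=G_0>\dots>G_M=1$ and choose $x_i$ with $G_{i-1}=\langle x_i,G_i\rangle$ (a Mal'cev basis). Put $u_i=1-x_i$, $\mu(u_i)=k$ iff $x_i\in\tau_k(G)\setminus\tau_{k+1}(G)$. The cosets of products $u_1^{r_1}\cdots u_M^{r_M}$ with $\sum r_i\mu(u_i)\le n-1$ form a basis of $\mathfrak{R}G/I^n$; $G$ acts faithfully by right multiplication via integer matrices, and an ordering of the basis making all matrices upper unitriangular gives an embedding $G\to UT_d(\mathbb{Z})$, $d=\dim\mathfrak{R}G/I^n$. The image is undistorted if the distortion function $\Delta_H^K(n)=\max\{dist_H(1,h): h\in H,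 dist_K(1,h)\le n\}$ (word metrics) satisfies $\Delta_H^K(n)\le Cn$ for some constant $C$. *)

(* Defs.v *)
From HB Require Import structures.
From mathcomp Require Import all_boot all_order all_algebra.
Set Implicit Arguments. Unset Strict Implicit. Unset Printing Implicit Defensive.
Import Order.TTheory GRing.Theory Num.Theory.

Section GroupDefs.
Variable gT : groupType.
Local Open Scope group_scope.

Definition zexpg (x : gT) (z : int) : gT :=
  match z with Posz n => x ^+ n | Negz n => (x ^+ n.+1)^-1 end.

Inductive gen (P : gT -> Prop) : gT -> Prop :=
| gen1 : gen P 1
| genP x : P x -> gen P x
| genV x : gen P x -> gen P x^-1
| genM x y : gen P x -> gen P y -> gen P (x * y).

Definition commset (P Q : gT -> Prop) (z : gT) : Prop :=
  exists x y, P x /\ Q y /\ z = [~ x, y].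

(* lower central series: lcs i = Gamma_i(G), with Gamma_1 = G,
   Gamma_{i+1} = [Gamma_i, G]; by convention lcs 0 = G as well. *)
Fixpoint lcs (i : nat) : gT -> Prop :=
  match i with
  | 0 => fun _ => True
  | S k => match k with
           | 0 => fun _ => True
           | _ => gen (commset (lcs k) (fun _ => True))
           end
  end.

Definition isolator (i : nat) (g : gT) : Prop :=
  exists k, (0 < k)%N /\ lcs i (g ^+ k).

Definition fin_generated : Prop :=
  exists S : seq gT, forall g, gen (fun x => x \in S) g.

Definition torsion_free : Prop :=
  forall (g : gT) k, (0 < k)%N -> g ^+ k = 1 -> g = 1.

Definition non_abelian : Prop := exists x y : gT, x * y <> y * x.

Definition nilpotent_of_class (c : nat) : Prop :=
  (forall g, lcs c.+1 g -> g = 1) /\ (exists g, lcs c g /\ g <> 1).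

Definition tau_group : Prop :=
  fin_generated /\ torsion_free /\ non_abelian /\ exists c, nilpotent_of_class c.

Definition free_basis (P : gT -> Prop) (B : seq gT) : Prop :=
  (forall b, b \in B -> P b) /\
  (forall g, P g -> exists a : seq int,
       size a = size B /\ g = \prod_(p <- zip B a) zexpg p.1 p.2) /\
  (forall a a' : seq int, size a = size B -> size a' = size B ->
       \prod_(p <- zip B a) zexpg p.1 p.2 = \prod_(p <- zip B a') zexpg p.1 p.2 ->
       a = a').

Definition rank_at_least (P : gT -> Prop) (r : nat) : Prop :=
  exists B, free_basis P B /\ (r <= size B)%N.

(* Mal'cev basis x_1..x_M (here xs`_0 .. xs`_(M-1)) adapted to the isolator
   series tau_1 > ... > tau_n = 1, n = c+1.
   subG xs i = G_i = < x_{i+1}, ..., x_M > (0-based: generated by xs`_j, j >= i),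
   so that G_{i-1} = < x_i, G_i >, G_0 = G, G_M = 1. *)
Definition subG (xs : seq gT) (i : nat) : gT -> Prop :=
  gen (fun y => exists j, (i <= j < size xs)%N /\ y = xs`_j).

Definition malcev_basis (c : nat) (xs : seq gT) : Prop :=
  (forall g, subG xs 0 g) /\
  (forall i, (i < size xs)%N -> forall g h,
      subG xs i g -> subG xs i.+1 h -> subG xs i.+1 (g^-1 * h * g)) /\
  (* G_i / G_{i+1} is infinite cyclic (generated by the image of x_{i+1}) *)
  (forall i, (i < size xs)%N -> forall m : int,
      subG xs i.+1 (zexpg xs`_i m) -> m = 0%R) /\
  (forall k, (1 <= k <= c.+1)%N ->
      exists i, (i <= size xs)%N /\ forall g, isolator k g <-> subG xs i g).

Definition weight_spec (xs : seq gT) (mu : nat -> nat) : Prop :=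
  forall j, (j < size xs)%N ->
    isolator (mu j) xs`_j /\ ~ isolator (mu j).+1 xs`_j.

End GroupDefs.

(* Group algebra R G, as formal finite R-linear combinations of group  *)
(* elements, compared coefficientwise.                                  *)
Section GroupAlgebra.
Variables (R : fieldType) (gT : groupType).
Local Open Scope ring_scope.

Definition RG := seq (R * gT).

Definition rg_coef (a : RG) (h : gT) : R := \sum_(p <- a | p.2 == h) p.1.
Definition rg_eq (a b : RG) : Prop := forall h, rg_coef a h = rg_coef b h.

Definition rg_add (a b : RG) : RG := a ++ b.
Definition rg_opp (a : RG) : RG := [seq (- p.1, p.2) | p <- a].
Definition rg_scale (r : R) (a : RG) : RG := [seq (r * p.1, p.2) | p <- a].
Definition rg_mul (a b : RG) : RG :=
  [seq (p.1 * q.1, (p.2 * q.2)%g) | p <- a, q <- b].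
Definition rg_of (g : gT) : RG := [:: (1, g)].
Definition rg_one : RG := rg_of 1%g.
Definition rg_prod (l : seq RG) : RG := foldr rg_mul rg_one l.
Definition rg_sum (l : seq RG) : RG := flatten l.
Definition rg_pow (a : RG) (k : nat) : RG := iter k (rg_mul a) rg_one.

Definition rg_aug (a : RG) : R := \sum_(p <- a) p.1.
Definition in_aug (a : RG) : Prop := rg_aug a = 0.

(* I^n (n >= 1): finite sums of products a_1 ... a_n with a_i in I *)
Definition in_aug_pow (n : nat) (a : RG) : Prop :=
  exists ls : seq (seq RG),
    (forall l, l \in ls -> size l = n /\ forall x, x \in l -> in_aug x) /\
    rg_eq a (rg_sum [seq rg_prod l | l <- ls]).

Definition cong_aug_pow (n : nat) (a b : RG) : Prop :=
  in_aug_pow n (rg_add a (rg_opp b)).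

Definition rg_u (x : gT) : RG := [:: (1, 1%g); (-1, x)].

Definition basis_elt (xs : seq gT) (r : seq nat) : RG :=
  rg_prod [seq rg_pow (rg_u p.1) p.2 | p <- zip xs r].

End GroupAlgebra.

Definition wdeg (mu : nat -> nat) (r : seq nat) : nat :=
  \sum_(j < size r) nth 0%N r j * mu j.

(* bs is an enumeration (ordering) of the exponent vectors (r_1..r_M) with
   sum r_i mu(u_i) <= n - 1 = c, i.e. of the basis of R G / I^(c+1). *)
Definition basis_enum (M c : nat) (mu : nat -> nat) (bs : seq (seq nat)) : Prop :=
  uniq bs /\ forall r, r \in bs <-> (size r = M /\ (wdeg mu r <= c)%N).

(* phi g is the matrix (with integer entries) of right multiplication by g
   on R G / I^(c+1) in the ordered basis given by bs:
   b_i * g = sum_j (phi g)_{ij} b_j  mod I^(c+1). *)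
Definition jennings_rep (R : fieldType) (gT : groupType) (c : nat)
    (xs : seq gT) (bs : seq (seq nat)) (d : nat) (phi : gT -> 'M[int]_d) : Prop :=
  forall (g : gT) (i : 'I_d),
    cong_aug_pow c.+1
      (rg_mul (basis_elt R xs (nth [::] bs i)) (rg_of R g))
      (rg_sum [seq rg_scale ((phi g i j)%:~R) (basis_elt R xs (nth [::] bs j))
              | j <- enum 'I_d]).

Definition unitriangular (d : nat) (A : 'M[int]_d) : Prop :=
  (forall i j : 'I_d, (j < i)%N -> A i j = 0%R) /\ (forall i, A i i = 1%R).

Definition mx_word_eval (d : nat) (w : seq (bool * 'M[int]_d)) : 'M[int]_d :=
  foldr (fun p acc => ((if p.1 then invmx p.2 else p.2) *m acc)%R) (1%:M)%R w.

Definition wlen_le (d : nat) (S : seq 'M[int]_d) (A : 'M[int]_d) (k : nat) : Prop :=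
  exists w : seq (bool * 'M[int]_d),
    (size w <= k)%N /\ (forall p, p \in w -> p.2 \in S) /\ mx_word_eval w = A.

Definition generates_image (gT : groupType) (d : nat) (phi : gT -> 'M[int]_d)
    (S : seq 'M[int]_d) : Prop :=
  (forall s, s \in S -> exists g, s = phi g) /\
  (forall g, exists k, wlen_le S (phi g) k).

Definition generates_UT (d : nat) (T : seq 'M[int]_d) : Prop :=
  (forall t, t \in T -> unitriangular t) /\
  (forall A, unitriangular A -> exists k, wlen_le T A k).

(* H = phi(G) is undistorted in K = UT_d(Z) (w.r.t. word metrics of S, T):
   Delta_H^K(n) <= C n for some C, i.e. for all h in H and all n,
   dist_K(1,h) <= n implies dist_H(1,h) <= C n. *)
Definition undistorted (gT : groupType) (d : nat) (phi : gT -> 'M[int]_d)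
    (S T : seq 'M[int]_d) : Prop :=
  exists C : nat, forall (g : gT) (n : nat),
    wlen_le T (phi g) n -> wlen_le S (phi g) (C * n).

(* Main.v *)
(** The entry of [phi g] in column [k] is, up to sign, the value at [b_i g] of a
    function [f_k] on [G]: the product of binomials of Mal'cev coordinates that
    is dual to the basis.  It is polynomial of degree at most [c], so that the
    [f_k] are functionals on [R G / I^(c+1)]; this gives the uniqueness of
    [phi], its multiplicativity, and the vanishing of every product of [c+1]
    factors [phi g - 1].  Expanding a product of [n] generators, the entries of
    an element of length [n] in the image are therefore [O(n^c)].

    A Mal'cev generator [x] of weight [c] acts as [1 - E_{i0,k}], where [i0] is
    the position of the basis element [1] and [k] that of [1 - x].  Since a
    power of [x] lies in [Gamma_c], and [phi] maps [Gamma_c] to matrices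
    supported at distance at least [c] from the diagonal, [k - i0 >= c].  If
    [Gamma_c] has rank at least 2, there are two such generators with distinct
    columns, so one of them has [D = k - i0 > c].  Iterated commutators give
    [1 - N^D E_{i0,k}] length [O(N)] in [UT_d(Z)], while in the image its
    length is at least of order [N^(D/c)]. *)
Require Import Defs.
From HB Require Import structures.
From mathcomp Require Import all_boot all_order all_algebra.
From mathcomp Require Import zify ring.
From Stdlib Require Import ClassicalEpsilon.
Set Implicit Arguments.
Unset Strict Implicit.
Unset Printing Implicit Defensive.
Import Order.TTheory GRing.Theory Num.Theory.

(** * Commutator calculus, the lower central series and its isolators *)

Section Groups.
Variable gT : groupType.
Implicit Types (P N : gT -> Prop) (g h x y z t : gT).
Local Open Scope group_scope.

Definition subgroup P :=
  [/\ P 1, (forall x y, P x -> P y -> P (x * y)) & (forall x, P x -> P x^-1)].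

Definition normal_subgroup N := subgroup N /\ forall x g, N x -> N (x ^ g).

Lemma subgroup_gen P : subgroup (gen P).
Proof. split; [exact: gen1 | exact: genM | exact: genV]. Qed.

Lemma subgroupX P x n : subgroup P -> P x -> P (x ^+ n).
Proof.
case=> P1 PM _ Px; elim: n => [|n IHn]; first by rewrite expg0.
by rewrite expgS; apply: PM.
Qed.

Lemma gen_min P Q : subgroup Q -> (forall x, P x -> Q x) ->
  forall x, gen P x -> Q x.
Proof.
case=> Q1 QM QV PQ x.
by elim=> [|y|y _|y z _ Qy _]; [| exact: PQ | exact: QV | exact: QM].
Qed.

Lemma gen_normal P : (forall x g, P x -> P (x ^ g)) -> normal_subgroup (gen P).
Proof.
move=> PJ; split=> [|x g]; first exact: subgroup_gen.
elim=> [|y /(PJ _ g)|y _|y z _ Py _ Pz].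
- by rewrite conj1g; exact: gen1.
- exact: genP.
- by rewrite conjVg; exact: genV.
- by rewrite conjMg; exact: genM.
Qed.

Lemma lcsSS i : @lcs gT i.+2 = gen (commset (@lcs gT i.+1) (fun=> True)).
Proof. by []. Qed.

Lemma lcs_normal i : normal_subgroup (@lcs gT i).
Proof.
elim: i => [|[|i] IHi]; try by do 2!split.
rewrite lcsSS; apply: gen_normal => _ g [y] [z] [Py [_ ->]].
exists (y ^ g), (z ^ g); split; last by rewrite conjRg.
by case: IHi => _; apply.
Qed.

Lemma lcs_subgroup i : subgroup (@lcs gT i).
Proof. by case: (lcs_normal i). Qed.

Lemma lcs_commT i x y : lcs i x -> lcs i.+1 [~ x, y].
Proof. by case: i => [//|i] Hx; rewrite lcsSS; apply: genP; exists x, y. Qed.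

Lemma lcsS i x : lcs i.+1 x -> lcs i x.
Proof.
case: i => [//|i]; rewrite lcsSS; apply: gen_min; first exact: lcs_subgroup.
case: (lcs_normal i.+1) => -[_ M V] J _ [y] [z] [Py [_ ->]].
by rewrite commgEl; apply: M; [exact: V | exact: J].
Qed.

Lemma lcs_le i j x : (i <= j)%N -> lcs j x -> lcs i x.
Proof. by move/subnK<-; elim: (j - i)%N => [//|k IHk] /lcsS. Qed.

Lemma hall_witt x y z :
  [~ x, y^-1, z] ^ y * [~ y, z^-1, x] ^ z * [~ z, x^-1, y] ^ x = 1.
Proof. by rewrite /commg /conjg !gnorm. Qed.

Lemma cent_mod_subgroup N x : normal_subgroup N -> subgroup (fun y => N [~ x, y]).
Proof.
case=> [[N1 M V] J]; split=> [|y z Ny Nz|y Ny]; first by rewrite commg1.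
  suff ->: [~ x, y * z] = [~ x, z] * [~ x, y] ^ z by apply: M => //; apply: J.
  by rewrite /commg /conjg !gnorm.
suff ->: [~ x, y^-1] = [~ x, y]^-1 ^ (y^-1) by apply: J; apply: V.
by rewrite /commg /conjg !gnorm.
Qed.

Lemma comm_mod_sym N x y : subgroup N -> N [~ x, y] -> N [~ y, x].
Proof. by case=> _ _ V /V; rewrite invgR. Qed.

(** The three subgroups argument: for a generator [[~ u, v]] of the next term, the Hall-Witt
    identity expresses [[~ u, v, x]], up to conjugation, through [[~ v^-1, x^-1, u]] and
    [[~ x, u^-1, v^-1]], and both fall under the induction hypothesis for [u]. The case [j = 0] is
    separate because [lcs 0] is the whole group. *)
Lemma lcs_comm i j x y : lcs i x -> lcs j y -> lcs (i + j) [~ x, y].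
Proof.
case: j => [|j].
  case: (lcs_normal i) => -[_ M V] J Px _; rewrite addn0 commgEl.
  by apply: M; [exact: V | exact: J].
elim: j i x y => [|j IHj] i x y Px; first by rewrite addn1 => _; apply: lcs_commT.
rewrite lcsSS; move: y; apply: gen_min.
  exact: (cent_mod_subgroup _ (lcs_normal _)).
move=> _ [u] [v] [Pu [_ ->]].
apply: (comm_mod_sym (lcs_subgroup _)).
case: (lcs_normal (i + j.+2)) => -[_ M V] J.
have := hall_witt v^-1 x u; rewrite invgK => /mulg1_eq E.
rewrite -[_ [~ _, _]]/(lcs (i + j.+2) [~ [~ u, v], x]).
suff: lcs (i + j.+2) ([~ u, v, x] ^ v^-1) by move/(J _ v); rewrite conjgKV.
rewrite -E; apply: V; apply: M; apply: J.
  have -> : (i + j.+2 = i.+1 + j.+1)%N by lia.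
  apply: IHj => //; apply: comm_mod_sym; first exact: lcs_subgroup.
  by apply: lcs_commT; case: (lcs_subgroup i) => _ _; apply.
rewrite addnS; apply: lcs_commT; apply: IHj => //.
by case: (lcs_subgroup j.+1) => _ _; apply.
Qed.

Definition eqmod N x y := N (x^-1 * y).

Lemma eqmod_mul N x y z t : normal_subgroup N ->
  eqmod N x y -> eqmod N z t -> eqmod N (x * z) (y * t).
Proof.
move=> [[_ M _] J] xy zt; rewrite /eqmod.
suff ->: (x * z)^-1 * (y * t) = (x^-1 * y) ^ z * (z^-1 * t) by apply: M => //; apply: J.
by rewrite /conjg !gnorm.
Qed.

Lemma eqmod_refl N x : subgroup N -> eqmod N x x.
Proof. by case=> N1 _ _; rewrite /eqmod mulVg. Qed.

Lemma eqmod_trans N y x z : subgroup N -> eqmod N x y -> eqmod N y z -> eqmod N x z.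
Proof.
by case=> _ M _ xy yz; have := M _ _ xy yz; rewrite mulgA mulgK.
Qed.

Lemma eqmod_comm N x y : subgroup N -> N [~ x, y] -> eqmod N (y * x) (x * y).
Proof. by move=> sN; rewrite /eqmod /commg /conjg !gnorm. Qed.

Lemma expgMn_mod N x y n : normal_subgroup N -> N [~ x, y] ->
  eqmod N ((x * y) ^+ n) (x ^+ n * y ^+ n).
Proof.
move=> nN Nxy; have sN := nN.1.
elim: n => [|n IHn]; first by rewrite !expg0 mulg1; exact: eqmod_refl.
rewrite (expgSr (x * y)) (expgSr x) (expgSr y).
apply: (eqmod_trans sN (eqmod_mul nN IHn (eqmod_refl _ sN))).
have -> : x ^+ n * y ^+ n * (x * y) = x ^+ n * (y ^+ n * x) * y by rewrite !mulgA.
have -> : x ^+ n * x * (y ^+ n * y) = x ^+ n * (x * y ^+ n) * y by rewrite !mulgA.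
apply: eqmod_mul => //; last exact: eqmod_refl.
apply: eqmod_mul => //; first exact: eqmod_refl.
apply: eqmod_comm => //.
exact: (subgroupX n (cent_mod_subgroup x nN) Nxy).
Qed.

Definition isolated N := forall x k, (0 < k)%N -> N (x ^+ k) -> N x.

(* Follow the Engel sequence h, [g,h], [g,[g,h]], ... down to N: one step
   before the end the commutator t commutes with g, so [g^k, _] is t^k mod N. *)
Lemma comm_root N m g h k : normal_subgroup N -> isolated N ->
    (forall x, lcs m x -> N x) -> (0 < k)%N ->
  N [~ g ^+ k, h] -> N [~ g, h].
Proof.
move=> nN iN mN k0 Nh; have sN := nN.1; have [_ M V] := sN.
pose e j := iter j (fun t => [~ g, t]) h.
have Ce j : N [~ g ^+ k, e j].
  elim: j => [//|j IHj] /=.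
  have [_ cM cV] := cent_mod_subgroup (g ^+ k) nN.
  have cg : N [~ g ^+ k, g].
    by apply: comm_mod_sym => //; rewrite commgXg; case: sN.
  rewrite /commg /conjg; apply: (cM); first exact: cV.
  by apply: (cM); [exact: cV | exact: cM].
have lcs_e j : lcs j.+1 (e j).
  elim: j => [//|j IHj]; apply: comm_mod_sym; first exact: lcs_subgroup.
  exact: lcs_commT.
have step j : N (e j.+2) -> N (e j.+1).
  move=> Nj; apply: (iN _ k k0).
  have E := expgMn_mod k nN (Nj : N [~ g, e j.+1]).
  have E2 : g * e j.+1 = g ^ e j by rewrite /= commgEl mulVKg.
  move: (E); rewrite E2 -conjXg /eqmod => E'.
  have := M _ _ (Ce j) E'; rewrite commgEl; congr N.
  by rewrite !gnorm.
have: N (e m.+1) by apply: mN; apply: (lcs_le _ (lcs_e m.+1)); lia.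
by elim: m {mN} => [//|m IHm] /step.
Qed.

Lemma isolator_lcs i x : lcs i x -> isolator i x.
Proof. by exists 1%N; rewrite expg1. Qed.

Lemma isolator_isolated i : isolated (@isolator gT i).
Proof.
move=> x k k0 [l [l0 H]]; exists (k * l)%N.
by rewrite muln_gt0 k0 l0 expgnA.
Qed.

Lemma isolatorJ i x g : isolator i x -> isolator i (x ^ g).
Proof.
by case=> k [k0 H]; exists k; split=> //; rewrite -conjXg; apply: (lcs_normal i).2.
Qed.

Lemma isolator_le i j x : (i <= j)%N -> isolator j x -> isolator i x.
Proof. by move=> ij [k [k0 H]]; exists k; split=> //; apply: lcs_le ij H. Qed.

(** The commutator of suitable powers lies in [lcs (i + j)]; [comm_root] then removes the exponents,
    one argument at a time. The subgroup premise is supplied by [isolator_subgroup] once a Mal'cev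
    basis is given. *)
Lemma isolator_comm i j x y : subgroup (@isolator gT (i + j)) ->
  isolator i x -> isolator j y -> isolator (i + j) [~ x, y].
Proof.
move=> sN [k [k0 Hx]] [l [l0 Hy]].
have nN : normal_subgroup (@isolator gT (i + j)) by split=> // z g; apply: isolatorJ.
have root := comm_root nN (@isolator_isolated _) (@isolator_lcs _).
apply: (root _ _ k) => //; apply: comm_mod_sym => //.
apply: (root _ _ l) => //; apply: comm_mod_sym => //.
by apply: isolator_lcs; apply: lcs_comm.
Qed.

Lemma zexpgS x a : zexpg x (a + 1)%R = zexpg x a * x.
Proof.
case: a => [n|[|n]].
- by rewrite -PoszD addn1 /zexpg expgSr.
- by rewrite /= mulVg.
have -> : (Negz n.+1 + 1)%R = Negz n by lia.
by rewrite /zexpg [x ^+ n.+2]expgS invgM mulgVK.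
Qed.

Lemma zexpgD x a b : zexpg x (a + b)%R = zexpg x a * zexpg x b.
Proof.
elim/int_ind: b => [|n IHn|n IHn].
- by rewrite addr0 mulg1.
- have -> : (a + n.+1 = a + n + 1)%R by lia.
  have -> : (n.+1%:Z = n%:Z + 1)%R by lia.
  by rewrite !zexpgS IHn mulgA.
have E : (a - n%:Z = (a - n.+1%:Z) + 1)%R by lia.
have E' : (- n%:Z = (- n.+1%:Z) + 1)%R by lia.
by move: IHn; rewrite E E' !zexpgS mulgA => /mulIg.
Qed.

Lemma zexpg1 x : zexpg x 1%R = x. Proof. by []. Qed.

Lemma zexpgN x a : zexpg x (- a)%R = (zexpg x a)^-1.
Proof. by apply/esym/mulg1_eq; rewrite -zexpgD addrN. Qed.

Lemma subgroup_zexpg P x a : subgroup P -> P x -> P (zexpg x a).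
Proof.
move=> sP Px; case: a => n /=; first exact: subgroupX.
by case: (sP) => _ _; apply; apply: (@subgroupX P x n.+1).
Qed.

End Groups.

(** * Functions on the group as linear functionals on the group algebra *)

Section Pairing.
Variables (gT : groupType) (R : fieldType).
Implicit Types (f : gT -> R) (a b c : RG R gT) (g h x : gT) (P : gT -> Prop).
Local Open Scope ring_scope.

(** Elements of the group algebra are unreduced lists; they are handled through these functionals,
    which respect [rg_eq] by [pair_rg_eq]. *)
Definition pair f a : R := \sum_(p <- a) p.1 * f p.2.

Lemma pair_cat f a b : pair f (a ++ b) = pair f a + pair f b.
Proof. exact: big_cat. Qed.

Lemma pair_opp f a : pair f (rg_opp a) = - pair f a.
Proof.
by rewrite /pair big_map -sumrN; apply: eq_bigr => p _; rewrite /= mulNr.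
Qed.

Lemma pair_scale f r a : pair f (rg_scale r a) = r * pair f a.
Proof.
by rewrite /pair big_map mulr_sumr; apply: eq_bigr => p _; rewrite /= mulrA.
Qed.

Lemma pair_sum f (l : seq (RG R gT)) : pair f (rg_sum l) = \sum_(a <- l) pair f a.
Proof.
elim: l => [|a l IHl]; first by rewrite /pair !big_nil.
by rewrite big_cons -IHl -pair_cat.
Qed.

Lemma pair_of f g : pair f (rg_of R g) = f g.
Proof. by rewrite /pair big_seq1 mul1r. Qed.

Lemma eq_pair f f' a : f =1 f' -> pair f a = pair f' a.
Proof. by move=> ff'; apply: eq_bigr => p _; rewrite ff'. Qed.

Lemma pairZf r f a : pair (fun g => r * f g) a = r * pair f a.
Proof. by rewrite mulr_sumr; apply: eq_bigr => p _; rewrite mulrCA. Qed.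

Lemma pairBf f f' a : pair (fun g => f g - f' g) a = pair f a - pair f' a.
Proof. by rewrite -sumrB; apply: eq_bigr => p _; rewrite mulrBr. Qed.

Lemma pair_cst r a : pair (fun=> r) a = rg_aug a * r.
Proof. by rewrite /rg_aug mulr_suml. Qed.

Lemma pair_mul f a b :
  pair f (rg_mul a b) = \sum_(p <- a) p.1 * pair (fun g => f (p.2 * g)%g) b.
Proof.
rewrite /pair /rg_mul big_allpairs_dep /=; apply: eq_bigr => p _.
by rewrite mulr_sumr; apply: eq_bigr => q _; rewrite mulrA.
Qed.

Lemma pair_mulr f a b :
  pair f (rg_mul a b) = \sum_(q <- b) q.1 * pair (fun g => f (g * q.2)%g) a.
Proof.
rewrite pair_mul; under eq_bigr do rewrite mulr_sumr.
rewrite exchange_big; apply: eq_bigr => q _; rewrite /pair mulr_sumr.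
by apply: eq_bigr => p _ /=; ring.
Qed.

Lemma pair_mul_of f a g : pair f (rg_mul a (rg_of R g)) = pair (fun h => f (h * g)%g) a.
Proof. by rewrite pair_mulr big_seq1 mul1r. Qed.

Lemma pair_mulA f a b c :
  pair f (rg_mul (rg_mul a b) c) = pair f (rg_mul a (rg_mul b c)).
Proof.
rewrite pair_mulr pair_mul; under eq_bigr do rewrite pair_mul mulr_sumr.
rewrite exchange_big; apply: eq_bigr => p _; rewrite pair_mulr mulr_sumr.
apply: eq_bigr => q _ /=; rewrite mulrCA; congr (_ * (_ * _)).
by apply: eq_pair => g; rewrite mulgA.
Qed.

Lemma pair_one_mul f a : pair f (rg_mul (rg_one R gT) a) = pair f a.
Proof. by rewrite pair_mul big_seq1 mul1r; apply: eq_pair => g; rewrite mul1g. Qed.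

Lemma pair_mul_one f a : pair f (rg_mul a (rg_one R gT)) = pair f a.
Proof. by rewrite pair_mul_of; apply: eq_pair => g; rewrite mulg1. Qed.

Lemma pair_u_mul f x a :
  pair f (rg_mul (rg_u R x) a) = pair (fun g => f g - f (x * g)%g) a.
Proof.
rewrite pairBf pair_mul big_cons big_seq1 /= mul1r mulN1r; congr (_ - _).
by apply: eq_pair => g; rewrite mul1g.
Qed.

Lemma pair_coef f a (s : seq gT) : uniq s -> {subset map snd a <= s} ->
  pair f a = \sum_(h <- s) rg_coef a h * f h.
Proof.
move=> us sub; under [RHS]eq_bigr do rewrite mulr_suml.
rewrite (exchange_big_dep predT) //= /pair big_seq [RHS]big_seq.
apply: eq_bigr => p pa.
rewrite -big_filter (@eq_filter _ _ (pred1 p.2)) ?filter_pred1_uniq ?big_seq1 //.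
by apply: sub; apply: map_f.
Qed.

Lemma pair_rg_eq f a b : rg_eq a b -> pair f a = pair f b.
Proof.
move=> ab; pose s := undup (map snd (a ++ b)).
have us : uniq s by exact: undup_uniq.
rewrite (pair_coef _ us) ?(pair_coef (a := b) _ us).
- by apply: eq_bigr => h _; rewrite ab.
- by move=> h; rewrite mem_undup map_cat mem_cat => ->; rewrite orbT.
- by move=> h; rewrite mem_undup map_cat mem_cat => ->.
Qed.

Definition supported P a := forall p, p \in a -> P p.2.

Lemma supported_mul P a b : subgroup P ->
  supported P a -> supported P b -> supported P (rg_mul a b).
Proof.
move=> [_ M _] sa sb p /allpairsP[[q r] /= [qa rb ->]] /=.
by apply: M; [exact: sa | exact: sb].
Qed.

Lemma supported_one P : subgroup P -> supported P (rg_one R gT).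
Proof. by case=> P1 _ _ p; rewrite inE => /eqP->. Qed.

Lemma supported_u_pow P x n : subgroup P -> P x -> supported P (rg_pow (rg_u R x) n).
Proof.
move=> sP Px; elim: n => [|n IHn]; first exact: supported_one.
apply: supported_mul => // p; rewrite !inE => /orP[] /eqP-> //=; by case: sP.
Qed.

Lemma supported_basis_elt P (xs : seq gT) r : subgroup P ->
  (forall x, x \in xs -> P x) -> supported P (basis_elt R xs r).
Proof.
move=> sP; elim: xs r => [|x xs IHxs] [|n r] Pxs; try exact: supported_one.
apply: supported_mul => //.
  by apply: supported_u_pow => //; apply: Pxs; rewrite mem_head.
by apply: IHxs => y yxs; apply: Pxs; rewrite inE yxs orbT.
Qed.

Lemma eq_pair_supported P f f' a : supported P a ->
  (forall g, P g -> f g = f' g) -> pair f a = pair f' a.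
Proof.
move=> sa ff'; rewrite /pair big_seq [RHS]big_seq; apply: eq_bigr => p pa.
by rewrite ff' //; apply: sa.
Qed.

(** The last factor acts on [f] by right translations, in accordance with the right differences that
    define polynomial degree below. *)
Lemma pair_prod_rcons f (l : seq (RG R gT)) a :
  pair f (rg_prod (rcons l a)) =
    \sum_(q <- a) q.1 * pair (fun g => f (g * q.2)%g) (rg_prod l).
Proof.
rewrite -pair_mulr; elim: l f => [|b l IHl] f /=.
  by rewrite pair_one_mul pair_mul_one.
by rewrite pair_mulA !pair_mul; apply: eq_bigr => p _; rewrite IHl.
Qed.

End Pairing.

(** * Binomial coefficients of integers in characteristic zero *)

Section Binomial.
Variable R : fieldType.
Hypothesis charR : [pchar R]%R =i pred0.
Local Open Scope ring_scope.

Definition binR (r : nat) (a : int) : R :=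
  (\prod_(i < r) (a%:~R - i%:R)) / r`!%:R.

Lemma natf_neq0_char0 n : (0 < n)%N -> n%:R != 0 :> R.
Proof. by move=> n0; rewrite ((pcharf0P _).1 charR) -lt0n. Qed.

Lemma binR0 a : binR 0 a = 1.
Proof. by rewrite /binR big_ord0 fact0 divr1. Qed.

Lemma binR_n0 r : binR r 0 = (r == 0%N)%:R.
Proof.
case: r => [|r]; first by rewrite binR0.
by rewrite /binR big_ord_recl /= subr0 !mul0r.
Qed.

(** Pascal's rule, valid for negative [a] as well. *)
Lemma binRS r a : binR r.+1 (a + 1) = binR r.+1 a + binR r a.
Proof.
rewrite /binR big_ord_recl [in X in _ = X + _]big_ord_recr /=.
rewrite (eq_bigr (fun i : 'I_r => a%:~R - i%:R)) => [|i _]; last first.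
  by rewrite /bump /= intrD -natr1; ring.
rewrite factS natrM intrD; set P := \prod_(i < r) _.
field.
by rewrite nat1r !natf_neq0_char0 ?fact_gt0.
Qed.

End Binomial.

(** * Polynomial functions on a filtered group *)

Section Polynomial.
Variables (gT : groupType) (R : fieldType) (F : nat -> gT -> Prop).
Hypothesis F0 : forall x, F 0 x.
Hypothesis FJ : forall i x y, F i x -> F i (x ^ y)%g.
Hypothesis FR : forall i j x y, F i x -> F j y -> F (i + j) [~ x, y]%g.
Implicit Types (H K : gT -> Prop) (f phi : gT -> R) (g h x : gT).
Implicit Type l : seq (nat * gT).
Local Open Scope ring_scope.

Definition rdiff h f g := f (g * h)%g - f g.

Fixpoint diffs l f : gT -> R :=
  if l is p :: l' then diffs l' (rdiff p.2 f) else f.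

(** Each direction is listed together with a weight, which may be any [w] with [F w h] and not only
    the largest one. *)
Fixpoint admissible H l : Prop :=
  if l is p :: l' then [/\ H p.2, F p.1 p.2 & admissible H l'] else True.

Definition weight l : nat := sumn (map fst l).

(* The functions of degree < n on H with respect to the filtration F. *)
Definition pol H n f := forall l, admissible H l -> (n <= weight l)%N ->
  forall g, H g -> diffs l f g = 0.

Lemma eq_diffs l f f' : f =1 f' -> diffs l f =1 diffs l f'.
Proof.
elim: l f f' => [//|p l IHl] f f' ff' /=; apply: IHl => g.
by rewrite /rdiff !ff'.
Qed.

Lemma diffsD l f f' g : diffs l (fun g => f g + f' g) g = diffs l f g + diffs l f' g.
Proof.
elim: l f f' => [//|p l IHl] f f' /=; rewrite -IHl.
by apply: eq_diffs => y; rewrite /rdiff; ring.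
Qed.

Lemma pol0 H f : pol H 0 f -> forall g, H g -> f g = 0.
Proof. by move=> /(_ [::] I (leqnn 0)). Qed.

Lemma polD H n f f' : pol H n f -> pol H n f' -> pol H n (fun g => f g + f' g).
Proof. by move=> pf pf' l al nl g Hg; rewrite diffsD pf ?pf' ?addr0. Qed.

Lemma pol_le H n m f : (n <= m)%N -> pol H n f -> pol H m f.
Proof. by move=> nm pf l al ml g Hg; apply: pf => //; apply: leq_trans ml. Qed.

Lemma pol_rdiff H n w h f : H h -> F w h -> pol H n f -> pol H (n - w) (rdiff h f).
Proof.
move=> Hh Fh pf l al; rewrite leq_subLR => nl; exact: (pf ((w, h) :: l)).
Qed.

(** [pol H] is the largest graded family that vanishes at level 0 and whose level drops by [w] under
    a difference of weight [w]. A degree bound is thus proved by exhibiting such a family. *)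
Lemma pol_coind H (Q : nat -> (gT -> R) -> Prop) :
    (forall f, Q 0%N f -> forall g, H g -> f g = 0) ->
    (forall n w h f, H h -> F w h -> Q n f -> Q (n - w)%N (rdiff h f)) ->
  forall n f, Q n f -> pol H n f.
Proof.
move=> Q0 QS n f Qf l; elim: l n f Qf => [|p l IHl] n f Qf /=.
  by move=> _; rewrite leqn0 => /eqP n0; apply: Q0; rewrite -n0.
case=> Hp Fp al nl; apply: (IHl (n - p.1)%N) => //; first exact: QS.
by move: nl; rewrite /weight /=; lia.
Qed.

Lemma pol_cst H a : pol H 1 (fun=> a).
Proof.
(* At level 0 the constant has to be 0; a difference of a constant is 0, so it may sit at any
   level. *)
pose Q n f := (n = 0%N -> forall g, f g = 0) /\ exists a, forall g, f g = a.
apply: (@pol_coind _ Q).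
- by move=> f [f0 _] g _; apply: f0.
- move=> n w h f _ _ [_ [b fb]]; have f0 g : rdiff h f g = 0 by rewrite /rdiff !fb subrr.
  by split=> //; exists 0.
- by split=> //; exists a.
Qed.

Lemma pol_transl H n h f : H h -> pol H n f -> pol H n (fun g => f (g * h)%g).
Proof.
move=> Hh pf; have := pol_rdiff Hh (F0 h) pf; rewrite subn0.
move=> /(polD pf) pfh l al nl g Hg; rewrite -(pfh l al nl g Hg).
by apply: eq_diffs => y; rewrite /rdiff; ring.
Qed.

Section Conj.
Variables (H : gT -> Prop) (x : gT) (w : nat).
Hypotheses (sH : subgroup H) (HJ : forall h, H h -> H (h ^ x)%g) (Fx : F w x).

Lemma pol_conj n f : pol H n f -> pol H n (fun g => f (g ^ x)%g).
Proof.
pose Q n f := exists2 f', pol H n f' & forall g, f g = f' (g ^ x)%g.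
move=> pf; apply: (@pol_coind _ Q); last by exists f.
  by move=> f1 [f' pf' E] g Hg; rewrite E; apply: (pol0 pf'); apply: HJ.
move=> m v h f1 Hh Fh [f' pf' E]; exists (rdiff (h ^ x)%g f').
  by apply: pol_rdiff => //; [exact: HJ | exact: FJ].
by move=> g; rewrite /rdiff !E conjMg.
Qed.

(** Since [g ^ x = g * [~ g, x]], this is a difference of [f] along a direction of weight [w] that
    varies with [g]. The dependence on [g] is removed by induction on the list of further
    directions. *)
Lemma pol_conj_sub n f : pol H n f -> pol H (n - w) (fun g => f (g ^ x)%g - f g).
Proof.
have [_ M V] := sH.
have HR h : H h -> H [~ h, x]%g.
  by move=> Hh; rewrite commgEl; apply: M; [exact: V | exact: HJ].
move=> pf l; elim: l n f pf => [|[v h] l IHl] n f pf /=.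
  rewrite /weight /= => _ nw g Hg.
  have := pol_rdiff (HR _ Hg) (FR (F0 g) Fx) pf.
  rewrite add0n => /(pol_le nw) /pol0 /(_ g Hg).
  by rewrite /rdiff /= commgEl mulVKg.
case=> Hh Fh al nl g Hg.
(* A difference along [h] yields the same expression for [rdiff h f], plus [q (g ^ x)], where the
   direction [[~ h, x]] is now fixed and has weight [v + w]. *)
pose q g := rdiff [~ h, x]%g f (g * h)%g.
rewrite (@eq_diffs l _ (fun g => (rdiff h f (g ^ x)%g - rdiff h f g) + q (g ^ x)%g)); last first.
  move=> y; rewrite /q /rdiff conjMg; move: (y ^ x)%g => z.
  have -> : (z * h * [~ h, x] = z * h ^ x)%g by rewrite -mulgA commgEl mulVKg.
  by ring.
rewrite diffsD (IHl (n - v)%N) //; first 1 last.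
- exact: pol_rdiff.
- by move: nl; rewrite /weight /=; lia.
rewrite add0r; apply: (@pol_conj (n - (v + w))%N) => //.
  by apply: pol_transl => //; apply: pol_rdiff => //; [exact: HR | exact: FR].
by move: nl; rewrite /weight /=; lia.
Qed.

End Conj.

(** * Extension of polynomial functions across an infinite cyclic factor *)

Section Extension.
Hypothesis charR : [pchar R] =i pred0.
Variables (H K : gT -> Prop) (x : gT) (mu : nat) (alpha : gT -> int).
Hypotheses (sH : subgroup H) (sK : subgroup K) (Hx : H x) (Fx : F mu x).
Hypotheses (KH : forall g, K g -> H g) (mu_gt0 : (0 < mu)%N).
Hypothesis alphaM : forall g h, H g -> H h -> alpha (g * h)%g = alpha g + alpha h.
Hypothesis alphax : alpha x = 1.
Hypothesis alphaK : forall g, H g -> (K g <-> alpha g = 0).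
(** With [FK], this says that the elements of [H] outside [K] have weight exactly [mu]: a direction
    in [H] is listed with weight at most [mu] or lies in [K]. *)
Hypothesis FH : forall w h, (w <= mu)%N -> H h -> F w h.
Hypothesis FK : forall w h, (mu < w)%N -> H h -> F w h -> K h.

(* For g = x^a k with k in K, kpart g is k. *)
Definition kpart g := (zexpg x (- alpha g) * g)%g.

Lemma alpha1 : alpha 1%g = 0.
Proof. by apply/alphaK; case: sK; case: sH. Qed.

Lemma alphaX a : alpha (zexpg x a) = a.
Proof.
have HX b : H (zexpg x b) by exact: subgroup_zexpg.
elim/int_ind: a => [|n IHn|n IHn].
- exact: alpha1.
- have -> : (n.+1%:Z = n%:Z + 1)%R by lia.
  by rewrite zexpgS alphaM // IHn alphax.
have E' : (- n%:Z = (- n.+1%:Z) + 1)%R by lia.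
by move: IHn; rewrite {1}E' zexpgS alphaM // alphax; lia.
Qed.

Lemma K_kpart g : H g -> K (kpart g).
Proof.
have [_ M _] := sH => Hg; have HX b : H (zexpg x b) by exact: subgroup_zexpg.
by apply/alphaK; [exact: M | rewrite alphaM // alphaX addNr].
Qed.

Lemma kpart_decomp g : g = (zexpg x (alpha g) * kpart g)%g.
Proof. by rewrite /kpart mulgA -zexpgD addrN mul1g. Qed.

Lemma kpart_id g : K g -> kpart g = g.
Proof.
by move=> Kg; rewrite /kpart ((alphaK (KH Kg)).1 Kg) oppr0 mul1g.
Qed.

Lemma kpartMr g h : H g -> K h -> kpart (g * h)%g = (kpart g * h)%g.
Proof.
move=> Hg Kh; rewrite /kpart alphaM //; last exact: KH.
by rewrite ((alphaK (KH Kh)).1 Kh) addr0 mulgA.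
Qed.

Lemma kpartMx g : H g -> kpart (g * x)%g = (kpart g ^ x)%g.
Proof.
move=> Hg; rewrite /kpart alphaM // alphax opprD addrC zexpgD [zexpg x (- 1)]zexpgN zexpg1.
by rewrite conjgE !mulgA.
Qed.

Lemma kpart_xM g : H g -> kpart (x * g)%g = kpart g.
Proof.
move=> Hg; rewrite /kpart alphaM // alphax opprD addrC zexpgD [zexpg x (- 1)]zexpgN zexpg1.
by rewrite -!mulgA mulKg.
Qed.

Lemma KJ h g : H g -> K h -> K (h ^ g)%g.
Proof.
have [_ M V] := sH => Hg Kh; have Hh := KH Kh.
have Hg' := V _ Hg; have Hhg := M _ _ Hh Hg.
apply/alphaK; first by rewrite conjgE; apply: M.
rewrite conjgE !alphaM // ((alphaK Hh).1 Kh) add0r -alphaM // mulVg.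
exact: alpha1.
Qed.

(** The family fed to [pol_coind]: sums of a binomial of index [r] in [alpha], counted with degree
    [r * mu], times a polynomial function on [K]. If [n <= r * mu], the truncated difference forces
    [phi] to vanish on [K]. *)
Inductive binspan (n : nat) (f : gT -> R) : Prop :=
| BinspanD f1 f2 : binspan n f1 -> binspan n f2 ->
    (forall g, H g -> f g = f1 g + f2 g) -> binspan n f
| BinspanB r phi : pol K (n - r * mu) phi ->
    (forall g, H g -> f g = binR R r (alpha g) * phi (kpart g)) -> binspan n f.

Lemma binspan_eq n f f' : (forall g, H g -> f' g = f g) -> binspan n f -> binspan n f'.
Proof.
move=> ff'; case=> [f1 f2 s1 s2 E|r phi pphi E].
  by apply: (BinspanD s1 s2) => g Hg; rewrite ff' // E.
by apply: (BinspanB pphi) => g Hg; rewrite ff' // E.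
Qed.

Lemma binspan0 f : binspan 0 f -> forall g, H g -> f g = 0.
Proof.
elim=> [f' f1 f2 _ IH1 _ IH2 E g Hg|f' r phi pphi E g Hg].
  by rewrite E // IH1 // IH2 // addr0.
by rewrite E // (pol0 pphi) ?mulr0 //; apply: K_kpart.
Qed.

Lemma binspan_le n m f : (n <= m)%N -> binspan n f -> binspan m f.
Proof.
move=> nm; elim=> [f' f1 f2 _ IH1 _ IH2 E|f' r phi pphi E]; first exact: (BinspanD IH1 IH2).
by apply: BinspanB E; apply: pol_le pphi; rewrite leq_sub2r.
Qed.

Lemma polN n L f : pol L n f -> pol L n (fun g => - f g).
Proof.
move=> pf l al nl g Lg; have := diffsD l f (fun g => - f g) g.
rewrite pf // add0r => <-; rewrite (@eq_diffs l _ (fun=> 0)); last by move=> y; rewrite subrr.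
suff E y f0 : f0 =1 (fun=> 0) -> diffs l f0 y = 0 by apply: E.
by elim: l f0 {al nl} => [|p l IH] f0 E //=; apply: IH => z; rewrite /rdiff !E subrr.
Qed.

Lemma binspanN n f : binspan n f -> binspan n (fun g => - f g).
Proof.
elim=> [f' f1 f2 _ IH1 _ IH2 E|f' r phi pphi E].
  by apply: (BinspanD IH1 IH2) => g Hg; rewrite E // opprD.
by apply: (BinspanB (polN pphi)) => g Hg; rewrite E // mulrN.
Qed.

Lemma binspan_rdiffK n w h f : K h -> F w h ->
  binspan n f -> binspan (n - w) (rdiff h f).
Proof.
have [_ M _] := sH.
move=> Kh Fh; have Hh := KH Kh; elim=> [f' f1 f2 _ IH1 _ IH2 E|f' r phi pphi E].
  apply: (BinspanD IH1 IH2) => g Hg; rewrite /rdiff !E //; last exact: M.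
  by ring.
apply: (@BinspanB _ _ r (rdiff h phi)).
  by rewrite subnAC; apply: pol_rdiff.
move=> g Hg; rewrite /rdiff !E //; last exact: M.
by rewrite kpartMr // alphaM // ((alphaK Hh).1 Kh) addr0 mulrBr.
Qed.

(** Right multiplication by [x] raises [alpha] by 1 and conjugates the [K]-part by [x]. By Pascal's
    rule the difference is a term with [phi (k ^ x) - phi k], of degree lower by [mu] by
    [pol_conj_sub], and a term whose binomial index drops by one. *)
Lemma binspan_rdiffx n f : binspan n f -> binspan (n - mu) (rdiff x f).
Proof.
have [_ M _] := sH; have KJx h := @KJ h x Hx.
elim=> [f' f1 f2 _ IH1 _ IH2 E|f' r phi pphi E].
  apply: (BinspanD IH1 IH2) => g Hg; rewrite /rdiff !E //; last exact: M.
  by ring.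
have s1 : binspan (n - mu) (fun g => binR R r (alpha g) *
                            (phi (kpart g ^ x)%g - phi (kpart g))).
  apply: (@BinspanB _ _ r (fun g => phi (g ^ x)%g - phi g)) => //.
  by rewrite subnAC; apply: pol_conj_sub.
case: r pphi E s1 => [|r] pphi E s1.
  apply: binspan_eq s1 => g Hg; rewrite /rdiff !E //; last exact: M.
  by rewrite !binR0 kpartMx // !mul1r.
apply: (BinspanD s1).
  apply: (@BinspanB _ _ r (fun g => phi (g ^ x)%g)) => //.
  by rewrite -subnDA -mulSn; apply: pol_conj.
move=> g Hg; rewrite /rdiff !E //; last exact: M.
by rewrite alphaM // alphax binRS // kpartMx //; ring.
Qed.

(* f(g x^-1) = f(g) - (rdiff x f)(g x^-1), and rdiff x f has lower degree. *)
Lemma binspan_translV n f : binspan n f -> binspan n (fun g => f (g * x^-1)%g).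
Proof.
have [_ M V] := sH.
elim/ltn_ind: n f => n IHn f sf.
have [n0|n0] := posnP n.
  move: sf; rewrite n0 => sf; apply: (binspan_eq _ sf) => g Hg.
  by rewrite !(binspan0 sf) //; apply: M => //; apply: V.
have lt : (n - mu < n)%N by rewrite ltn_subrL mu_gt0 n0.
have := binspanN (IHn _ lt _ (binspan_rdiffx sf)).
move/(binspan_le (leq_subr mu n)) => s2.
apply: (BinspanD sf s2) => g Hg; rewrite /rdiff mulgVK; ring.
Qed.

(** The directions with the required drop are closed under products and contain [K], [x] and [x^-1],
    hence all of [H]. *)
Lemma binspan_rdiff_low w h : (w <= mu)%N -> H h -> forall n f,
  binspan n f -> binspan (n - w) (rdiff h f).
Proof.
have [_ M V] := sH => wmu Hh.
(* All [v <= mu] are included because a difference along [y * z] is the sum of those along [y] and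
   [z] and of the iterated one, where [y] is applied with [v = 0]. *)
pose good g := H g /\ forall v n f, (v <= mu)%N -> binspan n f -> binspan (n - v) (rdiff g f).
have goodM y z : good y -> good z -> good (y * z)%g.
  move=> [Hy gy] [Hz gz]; split=> [|v n f vmu sf]; first exact: M.
  have := gy 0%N _ _ (leq0n _) (gz v _ _ vmu sf); rewrite subn0 => s1.
  have s2 : binspan (n - v) (fun g => rdiff y f g + rdiff z f g).
    exact: (BinspanD (gy v _ _ vmu sf) (gz v _ _ vmu sf)).
  by apply: (BinspanD s1 s2) => g Hg; rewrite /rdiff mulgA; ring.
have goodK k : K k -> good k.
  move=> Kk; split=> [|v n f vmu]; first exact: KH.
  by apply: binspan_rdiffK => //; apply: FH => //; apply: KH.
have goodx : good x.
  by split=> // v n f vmu /binspan_rdiffx; apply: binspan_le; lia.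
have goodV : good x^-1%g.
  split=> [|v n f vmu sf]; first exact: V.
  have := binspanN (binspan_translV (binspan_rdiffx sf)).
  move/(@binspan_le _ (n - v)%N _ (leq_sub2l n vmu)); apply: binspan_eq => g Hg.
  by rewrite /rdiff mulgVK; ring.
have good1 : good 1%g by apply: goodK; case: sK.
have goodX y n : good y -> good (y ^+ n)%g.
  by move=> gy; elim: n => [|n IHn]; [rewrite expg0 | rewrite expgS; apply: goodM].
suff: good h by case=> _ gh n f; apply: gh.
rewrite (kpart_decomp h); apply: goodM; last by apply: goodK; apply: K_kpart.
by case: (alpha h) => n /=; rewrite -?expVgn; apply: goodX.
Qed.

Definition binmul r phi g := binR R r (alpha g) * phi (kpart g).

(** [binspan] meets the conditions of [pol_coind]: weights up to [mu] are covered by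
    [binspan_rdiff_low], and a direction of larger weight lies in [K]. *)
Lemma pol_extend r n phi : pol K n phi -> pol H (n + r * mu) (binmul r phi).
Proof.
move=> pphi; apply: (@pol_coind _ binspan); first exact: binspan0.
  move=> m w h f Hh Fh; have [wmu|muw] := leqP w mu.
    exact: binspan_rdiff_low.
  by apply: binspan_rdiffK => //; apply: FK Fh.
by apply: (BinspanB (r := r) (phi := phi)) => //; rewrite addnK.
Qed.

(* Left multiplication by 1 - x lowers the index of the binomial by one. *)
Lemma pair_binmul_pow r s phi b : supported K b ->
  pair (binmul r phi) (rg_mul (rg_pow (rg_u R x) s) b) =
  (r == s)%:R * (-1) ^+ s * pair phi b.
Proof.
move=> sb; have [_ M _] := sH.
elim: s r => [|s IHs] r.
  rewrite pair_one_mul expr0 mulr1 -pairZf; apply: (eq_pair_supported sb) => g Kg.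
  by rewrite /binmul ((alphaK (KH Kg)).1 Kg) kpart_id // binR_n0.
have sH' : supported H (rg_mul (rg_pow (rg_u R x) s) b).
  by apply: supported_mul => // [|p /sb /KH //]; apply: supported_u_pow.
rewrite pair_mulA pair_u_mul; case: r => [|r].
  rewrite !mul0r -[RHS](mulr0 (rg_aug (rg_mul (rg_pow (rg_u R x) s) b))) -pair_cst.
  apply: (eq_pair_supported sH') => g Hg.
  by rewrite /binmul !binR0 kpart_xM // subrr.
rewrite (eq_pair_supported (f' := fun g => -1 * binmul r phi g) sH').
  by rewrite pairZf IHs exprS eqSS; ring.
move=> g Hg; rewrite /binmul kpart_xM // alphaM // alphax [1 + _]addrC binRS //; ring.
Qed.

End Extension.

(** Replacing [f (g * q)] by [f g] for the last factor costs a difference of lower degree, which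
    pairs to 0 with the shorter product by induction; what remains is multiplied by the augmentation
    of that factor. *)
Lemma pair_aug_prod H (l : seq (RG R gT)) f :
    (forall g, H g) -> (forall g, F 1 g) -> (forall a, a \in l -> in_aug a) ->
  pol H (size l) f -> pair f (rg_prod l) = 0.
Proof.
move=> HT F1; elim/last_ind: l f => [|l a IHl] f al pf.
  by rewrite pair_of (pol0 pf).
rewrite pair_prod_rcons.
rewrite (eq_bigr (fun q => q.1 * pair f (rg_prod l))) => [|q _].
  by rewrite -mulr_suml -/(rg_aug a) (al a) ?mul0r // mem_rcons mem_head.
apply: congr1; apply/eqP; rewrite -subr_eq0 -pairBf; apply/eqP.
apply: IHl => [b bl|]; first by apply: al; rewrite mem_rcons inE bl orbT.
by have := pol_rdiff (HT q.2) (F1 q.2) pf; rewrite size_rcons subn1.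
Qed.

Lemma pair_aug_pow H n a f : (forall g, H g) -> (forall g, F 1 g) ->
  pol H n f -> in_aug_pow n a -> pair f a = 0.
Proof.
move=> HT F1 pf [ls [Hls /(pair_rg_eq f) ->]].
rewrite pair_sum big_map big_seq big1 // => l /Hls [sl al].
by apply: (pair_aug_prod HT F1 al); rewrite sl.
Qed.

End Polynomial.

(** * Mal'cev coordinates and the functions dual to the Jennings basis *)

Section Malcev.
Variables (gT : groupType) (c : nat) (xs : seq gT) (mu : nat -> nat).
Hypothesis tfG : torsion_free gT.
Hypothesis nilG : forall g : gT, lcs c.+1 g -> g = 1%g.
Hypothesis malcev : malcev_basis c xs.
Hypothesis mu_spec : weight_spec xs mu.
Implicit Types (g h x y z : gT).
Local Open Scope group_scope.

Let M := size xs.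

Lemma isolator_trivial k g : (c < k)%N -> isolator k g -> g = 1.
Proof. by move=> ck [l [l0 H]]; apply: (tfG l0); apply: nilG; apply: lcs_le ck H. Qed.

(** Outside the range [1 <= k <= c.+1] of [malcev_basis], the isolator for [k = 0] coincides with
    that for 1, and those beyond [c.+1] are trivial like that for [c.+1]. *)
Lemma isolator_subG k : exists i, forall g, isolator k g <-> subG xs i g.
Proof.
have [_ [_ [_ iso]]] := malcev.
have [k0|k0] := posnP k.
  have [|i [_ Hi]] := iso 1%N; first by lia.
  by exists i => g; rewrite -Hi k0; split=> -[l [l0 _]]; exists l.
have [kc|ck] := leqP k c.+1.
  by have [|i [_ Hi]] := iso k; [lia | exists i].
have [|i [_ Hi]] := iso c.+1; first by lia.
exists i => g; rewrite -Hi; split; first by apply: isolator_le; lia.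
move/isolator_trivial => /(_ (leqnn _)) ->; exists 1%N; split=> //.
by rewrite expg1; case: (@lcs_subgroup gT k).
Qed.

Lemma isolator_subgroup k : subgroup (@isolator gT k).
Proof.
have [i Hi] := isolator_subG k; have [s1 sM sV] := subgroup_gen
  (fun y => exists j, (i <= j < size xs)%N /\ y = xs`_j).
by split=> [|x y|x]; rewrite !Hi; [exact: s1 | exact: sM | exact: sV].
Qed.

Lemma subG_subgroup i : subgroup (subG xs i).
Proof. exact: subgroup_gen. Qed.

Lemma subG_le i j g : (i <= j)%N -> subG xs j g -> subG xs i g.
Proof.
move=> ij; apply: gen_min; first exact: subG_subgroup.
by move=> _ [k [kj ->]]; apply: genP; exists k; split=> //; lia.
Qed.

Lemma subG_nth i j : (i <= j < M)%N -> subG xs i xs`_j.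
Proof. by move=> ij; apply: genP; exists j. Qed.

Lemma subG_nth_notin j : (j < M)%N -> ~ subG xs j.+1 xs`_j.
Proof. by move=> jM; have [_ [_ [inf _]]] := malcev; move/(inf j jM 1%R). Qed.

Lemma isolator_low j w h : (j < M)%N -> (w <= mu j)%N -> subG xs j h -> isolator w h.
Proof.
move=> jM wj; have [i Hi] := isolator_subG w; rewrite Hi; apply: subG_le.
rewrite leqNgt; apply/negP => ji; apply: (subG_nth_notin jM).
by apply: (subG_le ji); apply/Hi; apply: (isolator_le wj); case: (mu_spec jM).
Qed.

Lemma isolator_high j w h : (j < M)%N -> (mu j < w)%N -> isolator w h -> subG xs j.+1 h.
Proof.
move=> jM wj; have [i Hi] := isolator_subG w; rewrite Hi; apply: subG_le.
rewrite ltnNge; apply/negP => ij; have [_] := mu_spec jM; apply.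
by apply: (isolator_le wj); apply/Hi; apply: subG_nth; rewrite ij.
Qed.

Lemma mu_gt0 j : (j < M)%N -> (0 < mu j)%N.
Proof.
move=> jM; rewrite lt0n; apply/negP => /eqP m0.
by have [_] := mu_spec jM; apply; rewrite m0; exists 1%N.
Qed.

Lemma subG_conj j g h : (j < M)%N -> subG xs j g -> subG xs j.+1 h -> subG xs j.+1 (h ^ g).
Proof.
move=> jM Hg Hh; have [_ [nrm _]] := malcev.
by rewrite conjgE mulgA; apply: nrm.
Qed.

Lemma malcev_coordinate j : (j < M)%N -> exists alpha : gT -> int,
  [/\ forall g h, subG xs j g -> subG xs j h -> alpha (g * h) = (alpha g + alpha h)%R,
      alpha xs`_j = 1%R
    & forall g, subG xs j g -> (subG xs j.+1 g <-> alpha g = 0%R)].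
Proof.
move=> jM; set x := xs`_j.
have sH := subG_subgroup j; have [H1 HM HV] := sH.
have sK := subG_subgroup j.+1; have [K1 KM KV] := sK.
have Hx : subG xs j x by apply: subG_nth; rewrite leqnn.
have HX a : subG xs j (zexpg x a) by exact: subgroup_zexpg.
pose rel g a := exists2 k, subG xs j.+1 k & g = zexpg x a * k.
have rel_uniq g a b : rel g a -> rel g b -> a = b.
  move=> [k Kk ->] [k' Kk' E]; have [_ [_ [inf _]]] := malcev.
  suff : (- b + a = 0)%R by lia.
  apply: (inf j jM); rewrite -/x.
  have -> : zexpg x (- b + a)%R = k' * k^-1.
    by rewrite zexpgD zexpgN -(mulKg (zexpg x b) k') -E !mulgA mulgK.
  by apply: KM => //; apply: KV.
have relM g h a b : rel g a -> rel h b -> rel (g * h) (a + b)%R.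
  move=> [k Kk ->] [k' Kk' ->]; exists (k ^ zexpg x b * k').
    by apply: KM => //; apply: subG_conj.
  by rewrite zexpgD conjgE !mulgA mulgK.
have relV g a : rel g a -> rel g^-1 (- a)%R.
  move=> [k Kk ->]; exists (k^-1 ^ zexpg x (- a)).
    by apply: subG_conj => //; apply: KV.
  by rewrite conjgE mulVKg zexpgN invgM.
have rel_ex g : subG xs j g -> exists a, rel g a.
  elim=> [|y [i [ij ->]]|y _ [a ra]|y z _ [a ra] _ [b rb]].
  - by exists 0%R, 1; rewrite ?mulg1.
  - case: (ltngtP j i) ij => //= [ji iM|<- _].
      by exists 0%R, xs`_i; [apply: subG_nth; rewrite ji | rewrite mul1g].
    by exists 1%R, 1; rewrite ?mulg1.
  - by exists (- a)%R; apply: relV.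
  - by exists (a + b)%R; apply: relM.
pose alpha g := epsilon (inhabits 0%R) (rel g).
have alphaP g : subG xs j g -> rel g (alpha g).
  by move/rel_ex; exact: epsilon_spec.
exists alpha; split.
- move=> g h Hg Hh; apply: (rel_uniq (g * h)); first by apply: alphaP; apply: HM.
  by apply: relM; apply: alphaP.
- by apply: (rel_uniq x); [exact: alphaP | exists 1; rewrite ?mulg1].
- move=> g Hg; split=> [Kg|a0]; last first.
    by have [k Kk ->] := alphaP g Hg; rewrite a0 mul1g.
  by apply: (rel_uniq g); [exact: alphaP | exists g; rewrite ?mul1g].
Qed.

Variable R : fieldType.
Hypothesis charR : [pchar R]%R =i pred0.

Local Notation polG := (pol (@isolator gT)).

(** Descending induction along the Mal'cev series: each step multiplies the function on
    [subG xs i.+1] by the binomial of index [r_i] in the new coordinate. The signs arise because the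
    basis uses [1 - x] instead of [x - 1]. *)
Lemma dual_exists i (r : seq nat) : (i <= M)%N -> size r = M ->
  exists f : gT -> R,
    polG (subG xs i) (\sum_(i <= k < M) nth 0 r k * mu k).+1 f /\
    forall s, size s = M ->
      pair f (basis_elt R (drop i xs) (drop i s)) =
        ((drop i r == drop i s)%:R * (-1) ^+ sumn (drop i s))%R.
Proof.
move=> iM sr; rewrite -(subKn iM); move: (M - i)%N (leq_subr i M) => {i iM} n.
elim: n => [_|n IHn nM].
  exists (fun=> 1%R); split; first by rewrite subn0 big_geq //; exact: pol_cst.
  move=> s ss; rewrite subn0 !drop_oversize ?sr ?ss // eqxx mul1r expr0.
  by rewrite pair_of.
have [phi [pphi dphi]] := IHn (ltnW nM).
set j := (M - n.+1)%N; have jS : (M - n = j.+1)%N by rewrite /j; lia.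
have jM : (j < M)%N by rewrite /j; lia.
rewrite jS in pphi dphi.
have [alpha [aM ax aK]] := malcev_coordinate jM.
have sH := subG_subgroup j; have sK := subG_subgroup j.+1.
have KH g : subG xs j.+1 g -> subG xs j g by apply: subG_le.
have Hx : subG xs j xs`_j by apply: subG_nth; rewrite leqnn.
exists (binmul xs`_j alpha (nth 0%N r j) phi); split.
  rewrite big_ltn // addnC -addSn.
  apply: (@pol_extend _ _ _ _ _ _ charR _ (subG xs j.+1) _ (mu j)) => //.
  - by move=> x; exists 1%N.
  - by move=> k x y; apply: isolatorJ.
  - by move=> k l x y; apply: isolator_comm; apply: isolator_subgroup.
  - by case: (mu_spec jM).
  - exact: mu_gt0.
  - by move=> w h; apply: isolator_low.
  - by move=> w h wj _; apply: isolator_high.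
move=> s ss; rewrite (drop_nth 1) // (drop_nth 0%N) ?ss // (drop_nth 0%N (s := r)) ?sr //.
rewrite /basis_elt /= (@pair_binmul_pow _ _ charR (subG xs j) (subG xs j.+1)) //.
  rewrite -/(basis_elt R (drop j.+1 xs) (drop j.+1 s)) dphi //= eqseq_cons exprD -mulnb natrM.
  by rewrite !mulrA; congr (_ * _)%R; rewrite -!mulrA; congr (_ * _)%R; rewrite mulrC.
apply: (supported_basis_elt (r := drop j.+1 s)) => // x /(nthP 1) [k].
rewrite size_drop => kM <-; rewrite nth_drop; apply: subG_nth.
by move: kM; rewrite -/M; lia.
Qed.

(* The linear independence in Jennings' theorem: a function of degree <= c on G
   is a functional on R G / I^(c+1), and these are dual to the basis. *)
Lemma dual_function (r : seq nat) : size r = M -> exists f : gT -> R,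
    polG (fun=> True) (wdeg mu r).+1 f /\
    forall s, size s = M ->
      pair f (basis_elt R xs s) = ((r == s)%:R * (-1) ^+ sumn s)%R.
Proof.
move=> sr; have [f [pf df]] := dual_exists (leq0n M) sr.
exists f; split=> [|s ss]; last by have := df s ss; rewrite !drop0.
rewrite /wdeg -(big_mkord xpredT (fun k => nth 0 r k * mu k)%N) sr => l al wl g _.
have [HT _] := malcev; apply: pf => //.
by elim: l al {wl} => //= p l IHl [_ Fp /IHl].
Qed.

End Malcev.

(** * Polynomial growth of matrix products on a vector killed by the nilpotent parts *)

Section Growth.
Variables (d : nat) (As : seq 'M[int]_d).
Implicit Types (A : 'M[int]_d) (w : 'cV[int]_d).
Local Open Scope ring_scope.

Definition l1norm w : nat := (\sum_i `|w i 0%R|)%N.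

Lemma l1norm_add w w' : (l1norm (w + w')%R <= l1norm w + l1norm w')%N.
Proof.
rewrite /l1norm -big_split leq_sum // => i _; rewrite mxE /=.
by move: (w i 0%R) (w' i 0%R) => a b; lia.
Qed.

Definition l1norm_mx A : nat := (\sum_i \sum_j `|A i j|)%N.

Lemma absz_sum I (s : seq I) (F : I -> int) :
  (`|(\sum_(i <- s) F i)%R| <= \sum_(i <- s) `|F i|)%N.
Proof.
elim: s => [|i s IHs]; first by rewrite !big_nil.
rewrite !big_cons; apply: leq_trans (leq_add (leqnn _) IHs).
by move: (F i) (\sum_(_ <- s) _)%R => a b; lia.
Qed.

Lemma l1norm_mul A w : (l1norm (A *m w)%R <= l1norm_mx A * l1norm w)%N.
Proof.
rewrite /l1norm /l1norm_mx big_distrl leq_sum // => i _; rewrite mxE.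
apply: (leq_trans (absz_sum _ _)); rewrite big_distrl leq_sum // => j _ /=.
rewrite abszM leq_mul2l; apply/orP; right.
by rewrite (bigD1 j) //= leq_addr.
Qed.

Fixpoint killed (m : nat) w : Prop :=
  if m is m'.+1 then forall A, A \in As -> killed m' ((A - 1%:M) *m w) else w = 0.

(* Expanding a product of n factors 1 + (A - 1), only products of at most m
   of the nilpotent parts survive, whence growth of degree m in n. *)
Lemma killed_growth : exists B : nat, forall m w, killed m.+1 w ->
  forall l, {subset l <= As} ->
  (l1norm (foldr mulmx w l) <= (1 + size l * B) ^ m * l1norm w)%N.
Proof.
exists (\sum_(A <- As) l1norm_mx (A - 1%:M))%N; set B := (\sum_(_ <- _) _)%N.
have leB A w : A \in As -> (l1norm ((A - 1%:M) *m w)%R <= B * l1norm w)%N.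
  move=> AAs; apply: (leq_trans (l1norm_mul _ _)); rewrite leq_mul2r.
  by rewrite /B (big_rem A) //= leq_addr orbT.
have split A w : A *m w = w + (A - 1%:M) *m w.
  by rewrite mulmxBl mul1mx addrC subrK.
elim=> [|m IHm] w kw l; elim/last_ind: l => [|l A IHl] sub; try by rewrite mul1n //.
- rewrite foldr_rcons split (kw A) ?addr0; last by apply: sub; rewrite mem_rcons mem_head.
  by move: IHl; rewrite !mul1n; apply => X Xl; apply: sub; rewrite mem_rcons inE Xl orbT.
- by rewrite /= mul0n addn0 exp1n mul1n.
have sub' : {subset l <= As} by move=> X Xl; apply: sub; rewrite mem_rcons inE Xl orbT.
have AAs : A \in As by apply: sub; rewrite mem_rcons mem_head.
have foldrD l' u u' : foldr mulmx (u + u') l' = foldr mulmx u l' + foldr mulmx u' l'.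
  by elim: l' => //= X l' ->; rewrite mulmxDr.
rewrite foldr_rcons split foldrD size_rcons.
apply: (leq_trans (l1norm_add _ _)).
apply: (leq_trans (leq_add (IHl sub') (IHm _ (kw A AAs) l sub'))).
set n := size l.
apply: (@leq_trans ((1 + n * B) ^ m.+1 * l1norm w + (1 + n * B) ^ m * (B * l1norm w)))%N.
  by rewrite leq_add2l leq_mul2l leB ?orbT.
rewrite mulnA -mulnDl leq_mul2r; apply/orP; right.
rewrite expnSr -mulnDr [in X in (_ <= X)%N]expnSr.
apply: leq_mul; last by lia.
by case: (m) => // m'; rewrite leq_exp2r //; lia.
Qed.

End Growth.

(** * Elementary unitriangular matrices, their word length, and matrices supported far from the
    diagonal *)

Section Unitriangular.
Variable d : nat.
Implicit Types (A X Y : 'M[int]_d) (i j k : 'I_d) (T : seq 'M[int]_d).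
Local Open Scope ring_scope.

Definition elem i j (a : int) : 'M[int]_d := 1%:M + a *: delta_mx i j.

Lemma elem_unitriangular i j a : (i < j)%N -> unitriangular (elem i j a).
Proof.
move=> ij; split=> [k l lk|k]; rewrite !mxE.
  have -> : (k == l) = false by apply/eqP => kl; rewrite kl ltnn in lk.
  case: eqP => [ki|_]; case: eqP => [lj|_]; rewrite ?andbF ?andbT ?mulr0 ?addr0 //=.
  by move: lk; rewrite ki lj; lia.
rewrite eqxx; case: eqP => [ki|_]; case: eqP => [kj|_]; rewrite ?mulr0 ?addr0 //=.
by move: ij; rewrite -ki -kj ltnn.
Qed.

Lemma elem0 i j : elem i j 0 = 1%:M.
Proof. by rewrite /elem scale0r addr0. Qed.

Lemma elemD i j a b : i != j -> elem i j a *m elem i j b = elem i j (a + b).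
Proof.
move=> ij; rewrite /elem mulmxDl mul1mx mulmxDr mulmx1 -scalemxAl -scalemxAr.
rewrite mul_delta_mx_0 ?scaler0; last by rewrite eq_sym.
by rewrite addr0 scalerDl -addrA [b *: _ + _]addrC.
Qed.

Lemma elem_comm i j k a b : i != j -> j != k -> i != k ->
  elem i j a *m (elem j k b *m (elem i j (- a) *m elem j k (- b))) = elem i k (a * b).
Proof.
move=> ij jk ik; rewrite /elem !scaleNr.
set X := a *: delta_mx i j; set Y := b *: delta_mx j k.
have XX : X *m X = 0.
  by rewrite -scalemxAl -scalemxAr mul_delta_mx_0 ?scaler0 // eq_sym.
have YY : Y *m Y = 0.
  by rewrite -scalemxAl -scalemxAr mul_delta_mx_0 ?scaler0 // eq_sym.
have YX : Y *m X = 0.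
  by rewrite -scalemxAl -scalemxAr mul_delta_mx_0 ?scaler0 // eq_sym.
have XY : (a * b) *: delta_mx i k = X *m Y.
  by rewrite -scalemxAl -scalemxAr mul_delta_mx scalerA.
have E1 : (1%:M + Y) *m (1%:M - X) = 1%:M + Y - X.
  by rewrite mulmxBr mulmx1 mulmxDl mul1mx YX addr0.
have E2 : (1%:M + X) *m (1%:M + Y - X) = 1%:M + Y + X *m Y.
  rewrite mulmxDl mul1mx mulmxBr mulmxDr mulmx1 XX subr0 addrA.
  by rewrite subrK.
have E3 : (1%:M + Y + X *m Y) *m (1%:M - Y) = 1%:M + X *m Y.
  rewrite mulmxBr mulmx1 mulmxDl mulmxDl mul1mx YY -mulmxA YY mulmx0 !addr0.
  by rewrite addrAC addrK.
by rewrite XY !mulmxA -[_ *m (1%:M + Y) *m _]mulmxA E1 E2 E3.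
Qed.

Lemma wlen_le_mul T A B m n : wlen_le T A m -> wlen_le T B n ->
  wlen_le T (A *m B) (m + n).
Proof.
move=> [v [sv [vT <-]]] [w [sw [wT <-]]]; exists (v ++ w); split.
  by rewrite size_cat leq_add.
split; first by move=> p; rewrite mem_cat => /orP[/vT|/wT].
by elim: v {sv vT} => [|p v IHv] /=; rewrite ?mul1mx // IHv mulmxA.
Qed.

Lemma wlen_le_leq T A m n : (m <= n)%N -> wlen_le T A m -> wlen_le T A n.
Proof. by move=> mn [w [sw H]]; exists w; split=> //; apply: leq_trans mn. Qed.

(** Both signs are treated because the commutators of [elem_wlen] also contain the inverses of their
    entries. *)
Lemma elem_wlen_linear T i j : generates_UT T -> (i < j)%N -> exists C : nat,
  forall (N : nat) (s : bool), wlen_le T (elem i j ((-1) ^+ s * N%:Z)) (C * N).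
Proof.
move=> [_ genT] ij.
have [k1 H1] := genT _ (elem_unitriangular 1 ij).
have [k2 H2] := genT _ (elem_unitriangular (-1) ij).
exists (k1 + k2)%N => N s.
have Hs : wlen_le T (elem i j ((-1) ^+ s)) (k1 + k2).
  by case: s; [apply: wlen_le_leq H2; lia | apply: wlen_le_leq H1; lia].
have nij : i != j by rewrite -val_eqE /=; lia.
elim: N => [|N IHN]; first by rewrite mulr0 elem0 muln0; exists [::].
rewrite -[N.+1]add1n PoszD mulrDr mulr1 -elemD // mulnDr muln1.
exact: wlen_le_mul.
Qed.

(** Induction on [j - i]: the commutator of the elementary matrices with entries [N ^ (D.+1)] and
    [N] has entry [N ^ (D.+2)], and its length is at most twice the sum of theirs, hence still
    linear in [N]. *)
Lemma elem_wlen T i j : generates_UT T -> (i < j)%N -> exists C : nat,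
  forall (N : nat) (s : bool),
    wlen_le T (elem i j ((-1) ^+ s * (N ^ (j - i))%N%:Z)) (C * N).
Proof.
move=> genT ij; have [D jD] : exists D, (j = i + D.+1 :> nat)%N.
  by exists (j - i.+1)%N; lia.
have -> : (j - i = D.+1)%N by lia.
elim: D j ij jD => [|D IHD] j ij jD; first exact: elem_wlen_linear.
have kd : (i + D.+1 < d)%N by rewrite (leq_trans _ (ltn_ord j)) // jD; lia.
(* The intermediate index is [j - 1], so the second factor contributes just one power of [N]. *)
pose k := Ordinal kd.
have ik : (i < k)%N by rewrite /=; lia.
have kj : (k < j)%N by rewrite /= jD; lia.
have [C HC] := IHD k ik erefl.
have [C1 HC1] := elem_wlen_linear genT kj.
exists (2 * C + 2 * C1)%N => N s.
have -> : (-1) ^+ s * (N ^ D.+2)%N%:Z = ((-1) ^+ s * (N ^ D.+1)%N%:Z) * N%:Z.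
  by rewrite expnSr PoszM mulrA.
rewrite -(elem_comm (j := k)); try by rewrite -val_eqE /=; lia.
have -> : - ((-1) ^+ s * (N ^ D.+1)%N%:Z) = (-1) ^+ (~~ s) * (N ^ D.+1)%N%:Z.
  by case: s; rewrite ?expr0 ?expr1 ?mulN1r ?mul1r ?opprK.
have -> : ((2 * C + 2 * C1) * N =
           C * N + (C1 * N + (C * N + C1 * N)))%N by ring.
apply: wlen_le_mul; first exact: HC.
apply: wlen_le_mul; first by have := HC1 N false; rewrite mul1r.
apply: wlen_le_mul; first exact: HC.
by have := HC1 N true; rewrite expr1 mulN1r.
Qed.

Definition band (k : nat) A := forall i j : 'I_d, (j < i + k)%N -> A i j = 0.

Lemma bandD (k : nat) A B : band k A -> band k B -> band k (A + B).
Proof. by move=> bA bB i j ij; rewrite mxE bA ?bB ?addr0. Qed.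

Lemma bandN (k : nat) A : band k A -> band k (- A).
Proof. by move=> bA i j ij; rewrite mxE bA ?oppr0. Qed.

Lemma bandM (k l : nat) A B : band k A -> band l B -> band (k + l) (A *m B).
Proof.
move=> bA bB i j ij; rewrite mxE big1 // => m _.
have [mi|mi] := ltnP m (i + k); first by rewrite bA ?mul0r.
by rewrite bB ?mulr0 //; lia.
Qed.

Lemma unitriangular_band A : unitriangular A -> band 0 A.
Proof. by move=> [lowA _] i j ij; apply: lowA; lia. Qed.

Lemma unitriangular_sub1_band A : unitriangular A -> band 1 (A - 1%:M).
Proof.
move=> [lowA diagA] i j; rewrite addn1 ltnS leq_eqVlt => /orP[/eqP/val_inj->|ji].
  by rewrite !mxE diagA eqxx subrr.
by rewrite !mxE lowA // (negPf (_ : i != j)) ?subrr // -val_eqE /=; lia.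
Qed.

End Unitriangular.

(** * The basis elements [1] and [1 - x_j], given by the exponent vectors zero and
    [unit_exponent] *)

Lemma pair_basis_elt0 (R : fieldType) (gT : groupType) (f : gT -> R) xs n :
  pair f (basis_elt R xs (nseq n 0%N)) = f 1%g.
Proof.
elim: xs n => [|x xs IHxs] [|n]; try by rewrite pair_of.
by rewrite /basis_elt /= pair_one_mul -/(basis_elt R xs (nseq n 0%N)).
Qed.

Definition unit_exponent (M j : nat) := nseq j 0%N ++ 1%N :: nseq (M - j.+1) 0%N.

Lemma size_unit_exponent M j : (j < M)%N -> size (unit_exponent M j) = M.
Proof. by move=> jM; rewrite size_cat /= !size_nseq; lia. Qed.

Lemma wdeg_unit_exponent mu M j : (j < M)%N -> wdeg mu (unit_exponent M j) = mu j.
Proof.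
move=> jM; rewrite /wdeg size_unit_exponent // (bigD1 (Ordinal jM)) //=.
rewrite nth_cat size_nseq ltnn subnn mul1n big1 ?addn0 // => i ij.
have {}ij : (i != j :> nat) by rewrite -val_eqE in ij.
rewrite nth_cat size_nseq nth_nseq; case: ltnP => // ji.
have -> : (i - j = (i - j.+1).+1)%N by lia.
by rewrite /= nth_nseq; case: ifP.
Qed.

Lemma unit_exponent_inj M j k : unit_exponent M j = unit_exponent M k -> j = k.
Proof.
move/(congr1 (index 1%N)); rewrite !index_cat !mem_nseq !andbF /= !size_nseq.
by rewrite !addn0.
Qed.

Lemma pair_basis_elt1 (R : fieldType) (gT : groupType) (f : gT -> R) xs j :
  (j < size xs)%N ->
  pair f (basis_elt R xs (unit_exponent (size xs) j)) = (f 1%g - f (nth 1%g xs j))%R.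
Proof.
elim: xs j => [//|x xs IHxs] [|j] jM.
  rewrite /unit_exponent /= subn1 /= /basis_elt /= pair_mulA pair_u_mul pair_one_mul.
  by rewrite -/(basis_elt R xs (nseq (size xs) 0%N)) pair_basis_elt0 mulg1.
by rewrite /basis_elt /= pair_one_mul -(IHxs j).
Qed.

(** * The matrices of a Jennings representation *)

Section Representation.
Variables (gT : groupType) (c : nat) (xs : seq gT) (mu : nat -> nat).
Hypothesis tfG : torsion_free gT.
Hypothesis nilG : forall g : gT, lcs c.+1 g -> g = 1%g.
Hypothesis malcev : malcev_basis c xs.
Hypothesis mu_spec : weight_spec xs mu.
Variable R : fieldType.
Hypothesis charR : [pchar R]%R =i pred0.
Variables (bs : seq (seq nat)).
Hypothesis bs_enum : basis_enum (size xs) c mu bs.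
Variable phi : gT -> 'M[int]_(size bs).
Hypothesis phi_rep : jennings_rep R c xs bs phi.
Implicit Types (g h : gT) (f : gT -> R).
Local Open Scope ring_scope.

Local Notation d := (size bs).
Local Notation polG := (pol (@isolator gT) (fun=> True)).
Local Notation b i := (basis_elt R xs (nth [::] bs i)).
Local Notation toR := (map_mx (intr : int -> R)).

Let iso0 g : isolator 0 g. Proof. by exists 1%N. Qed.
Let iso1 g : isolator 1 g. Proof. by exists 1%N. Qed.

Definition coords f : 'cV[R]_d := \col_i pair f (b i).

Lemma intrR_inj : injective (intr : int -> R).
Proof.
move=> m n /eqP; rewrite -subr_eq0 -intrB => /eqP mn0.
apply/eqP; rewrite -subr_eq0; apply/eqP; move: (m - n) mn0 => [] k.
  by move/eqP; rewrite -[_%:~R]/(k%:R) ((pcharf0P _).1 charR) => /eqP->.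
rewrite NegzE mulrNz => /eqP; rewrite oppr_eq0 -[_%:~R]/(k.+1%:R).
by rewrite ((pcharf0P _).1 charR).
Qed.

Lemma toR_inj m n : injective (map_mx (intr : int -> R) : 'M_(m, n) -> 'M_(m, n)).
Proof.
move=> A B AB; apply/matrixP => i j; move/matrixP/(_ i j): AB.
by rewrite !mxE => /intrR_inj.
Qed.

Lemma size_bs i : (i < d)%N -> size (nth [::] bs i) = size xs.
Proof.
move=> id; have [_ /(_ (nth [::] bs i)) [+ _]] := bs_enum.
by rewrite mem_nth // => /(_ isT) [].
Qed.

Lemma wdeg_bs i : (i < d)%N -> (wdeg mu (nth [::] bs i) <= c)%N.
Proof.
move=> id; have [_ /(_ (nth [::] bs i)) [+ _]] := bs_enum.
by rewrite mem_nth // => /(_ isT) [].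
Qed.

(** A function of degree at most [c] vanishes on [I^(c+1)], so pairing with it turns the congruence
    that defines [phi g] into an equation: [phi g] acts on coordinate vectors by right
    translation. *)
Lemma toR_phi_coords g f : polG c.+1 f ->
  toR (phi g) *m coords f = coords (fun h => f (h * g)%g).
Proof.
move=> pf; apply/matrixP => i j; rewrite !mxE.
have /(pair_aug_pow (fun=> I) iso1 pf) := phi_rep g i.
rewrite /rg_add pair_cat pair_opp pair_mul_of => /eqP; rewrite subr_eq0 => /eqP ->.
rewrite pair_sum big_map big_enum /=; apply: eq_bigr => k _.
by rewrite pair_scale !mxE.
Qed.

(** Each standard basis vector is, up to the sign [e], the coordinate vector of a dual function. The
    degree is recorded for each [k] since the sharper bounds enter in [phi_generator]. *)
Lemma dual_coords (k : 'I_d) : exists f (e : R),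
  [/\ polG (wdeg mu (nth [::] bs k)).+1 f, e != 0 & coords f = e *: delta_mx k 0].
Proof.
have [f [pf df]] := dual_function tfG nilG malcev mu_spec charR (size_bs (ltn_ord k)).
exists f, ((-1) ^+ sumn (nth [::] bs k)); split=> //; first by rewrite signr_eq0.
apply/matrixP => i j; rewrite !mxE ord1 eqxx andbT df ?size_bs //.
have [ub _] := bs_enum; rewrite nth_uniq // val_eqE [k == i]eq_sym.
by case: eqP => [->|_]; rewrite ?mul1r ?mulr1 // mul0r mulr0.
Qed.

(** By [dual_coords] the coordinate vectors of functions of degree at most [c] span; characteristic
    0 carries the equality back to integer matrices. *)
Lemma eq_mx_coords (A B : 'M[int]_d) :
    (forall f, polG c.+1 f -> toR A *m coords f = toR B *m coords f) -> A = B.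
Proof.
move=> AB; apply: toR_inj; apply/matrixP => i k.
have [f [e [pf e0 cf]]] := dual_coords k.
have := AB f (pol_le _ pf); rewrite ltnS wdeg_bs // => /(_ isT).
rewrite cf -!scalemxAr => /(scalerI e0) /matrixP /(_ i 0).
by rewrite -!colE !mxE.
Qed.

Lemma polG_transl n g f : polG n f -> polG n (fun h => f (h * g)%g).
Proof. exact: pol_transl. Qed.

Lemma phiM g h : phi (g * h)%g = phi g *m phi h.
Proof.
apply: eq_mx_coords => f pf; rewrite map_mxM -mulmxA !toR_phi_coords //.
  by apply/matrixP => i j; rewrite !mxE; apply: eq_pair => y; rewrite mulgA.
exact: polG_transl.
Qed.

Lemma phi1 : phi 1%g = 1%:M.
Proof.
apply: eq_mx_coords => f pf; rewrite toR_phi_coords // map_mx1 mul1mx.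
by apply/matrixP => i j; rewrite !mxE; apply: eq_pair => y; rewrite mulg1.
Qed.

Lemma phi_mulV g : phi g *m phi g^-1%g = 1%:M.
Proof. by rewrite -phiM mulgV phi1. Qed.

Lemma invmx_phi g : invmx (phi g) = phi g^-1%g.
Proof.
have [ug _] := mulmx1_unit (phi_mulV g).
by rewrite -[RHS](mulKmx ug) phi_mulV mulmx1.
Qed.

Lemma toR_phi_sub1_coords g f : polG c.+1 f ->
  toR (phi g - 1%:M) *m coords f = coords (rdiff g f).
Proof.
move=> pf; rewrite map_mxB map_mx1 mulmxBl mul1mx toR_phi_coords //.
by apply/matrixP => i j; rewrite !mxE -pairBf.
Qed.

(** On coordinate vectors [phi g - 1] is the difference along [g], which lowers the degree because
    every [g] has weight at least 1. *)
Lemma killed_coords As : (forall A, A \in As -> exists g, A = phi g) ->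
  forall m w f e, (m <= c.+1)%N -> polG m f -> toR w = e *: coords f -> killed As m w.
Proof.
move=> AP; elim=> [|m IHm] w f e mc pf we /=.
  apply: toR_inj; rewrite we map_mx0; apply/matrixP => i j; rewrite !mxE.
  rewrite [pair _ _]big1 ?mulr0 // => p _; rewrite (pol0 pf) ?mulr0 //.
move=> _ /AP [g ->]; apply: (IHm _ (rdiff g f) e); first exact: ltnW.
  by have := pol_rdiff I (iso1 g) pf; rewrite subn1.
by rewrite map_mxM we -scalemxAr toR_phi_sub1_coords //; apply: pol_le pf.
Qed.

Lemma phi_entry_growth (S : seq 'M[int]_d) : generates_image phi S ->
  exists B : nat, forall g n (i k : 'I_d),
    wlen_le S (phi g) n -> (`|phi g i k| <= (1 + n * B) ^ c)%N.
Proof.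
(* Words may contain inverses of generators; these are again values of [phi]. *)
move=> [SP _]; pose As := S ++ map invmx S.
have AP A : A \in As -> exists g, A = phi g.
  rewrite mem_cat => /orP[/SP //|/mapP[B /SP [g ->] ->]].
  by exists g^-1%g; rewrite invmx_phi.
have [B HB] := killed_growth As; exists B => g n i k [w [wn [wS wE]]].
have [f [e [pf e0 cf]]] := dual_coords k.
have kd : killed As c.+1 (delta_mx k 0).
  apply: (killed_coords AP (f := f) (e := e^-1)) => //.
    by apply: pol_le pf; rewrite ltnS wdeg_bs.
  by rewrite map_delta_mx cf scalerA mulVf // scale1r.
pose l := [seq if p.1 then invmx p.2 else p.2 | p <- w].
have lAs : {subset l <= As}.
  move=> _ /mapP[[s A] /wS /= AS ->]; rewrite mem_cat.
  by case: s; rewrite ?AS // map_f ?orbT.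
have E u : mx_word_eval w *m u = foldr mulmx u l :> 'cV_d.
  rewrite /l; elim: (w) => [|p v IHv] /=; first by rewrite mul1mx.
  by rewrite -mulmxA IHv.
have := HB c _ kd l lAs; rewrite -E wE -colE.
have -> : l1norm (delta_mx k 0 : 'cV[int]_d) = 1%N.
  rewrite /l1norm (bigD1 k) //= mxE !eqxx big1 // => j jk.
  by rewrite mxE (negPf jk).
rewrite muln1 size_map => le1.
apply: (@leq_trans (l1norm (col k (phi g)))).
  by rewrite /l1norm (bigD1 i) //= !mxE leq_addr.
apply: leq_trans le1 _; case: (c) => // c'.
by rewrite leq_exp2r // leq_add2l leq_mul2r wn orbT.
Qed.

Hypothesis phiUT : forall g, unitriangular (phi g).

(* With A = 1 + X and B = 1 + Y, the commutator of A and B is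
   1 + A^-1 B^-1 (XY - YX). *)
Lemma phi_lcs_band k g : lcs k g -> band k (phi g - 1%:M).
Proof.
case: k => [_|k].
  by apply: bandD; [apply: unitriangular_band | apply: bandN => i j ij; rewrite !mxE;
    rewrite (negPf (_ : i != j)) // -val_eqE /=; lia].
elim: k g => [|k IHk] g; first by move=> _; apply: unitriangular_sub1_band.
rewrite lcsSS; elim=> [|_ [x] [y] [Px [_ ->]]|x _ IHx|x y _ IHx _ IHy].
- by rewrite phi1 subrr => i j _; rewrite mxE.
- have -> : phi [~ x, y]%g - 1%:M = phi x^-1%g *m (phi y^-1%g *m
      ((phi x - 1%:M) *m (phi y - 1%:M) - (phi y - 1%:M) *m (phi x - 1%:M))).
    have -> : (phi x - 1%:M) *m (phi y - 1%:M) - (phi y - 1%:M) *m (phi x - 1%:M)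
            = phi (x * y)%g - phi (y * x)%g.
      have sub1M (A B : 'M[int]_d) : (A - 1%:M) *m (B - 1%:M) = A *m B - (A + B - 1%:M).
        by rewrite mulmxBl mulmxBr !mul1mx mulmx1 -addrA -opprD addrA.
      rewrite !sub1M !phiM [phi y + phi x]addrC; move: (_ + _ - 1%:M) => Z.
      by rewrite opprB addrA subrK.
    rewrite !mulmxBr -!phiM -phi1 commgEl conjgE; congr (phi _ - phi _).
    by rewrite mulKg mulVg.
  rewrite -[k.+2]add0n; apply: bandM; first exact: unitriangular_band.
  rewrite -[k.+2]add0n; apply: bandM; first exact: unitriangular_band.
  apply: bandD; last apply: bandN.
    by rewrite -addn1; apply: bandM; [exact: IHk | exact: unitriangular_sub1_band].
  by rewrite -add1n; apply: bandM; [exact: unitriangular_sub1_band | exact: IHk].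
- have -> : phi x^-1%g - 1%:M = - (phi x^-1%g *m (phi x - 1%:M)).
    by rewrite mulmxBr mulmx1 -phiM mulVg phi1 opprB.
  apply: bandN; rewrite -[k.+2]add0n; apply: bandM => //; exact: unitriangular_band.
- have -> : phi (x * y)%g - 1%:M = (phi x - 1%:M) *m phi y + (phi y - 1%:M).
    by rewrite mulmxBl mul1mx phiM addrA subrK.
  apply: bandD => //; rewrite -[k.+2]addn0; apply: bandM => //; exact: unitriangular_band.
Qed.

(** A difference of weight [c] turns a function of degree at most [c] into a constant, and a
    constant sees only the augmentation, which is nonzero at the basis element [1] alone. So
    [phi x - 1] has one nonzero row, and evaluating the dual functions at [x] leaves a single entry
    in it. *)
Lemma phi_generator j : (j < size xs)%N -> mu j = c ->
  exists i0 k : 'I_d,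
    [/\ nth [::] bs i0 = nseq (size xs) 0%N,
        nth [::] bs k = unit_exponent (size xs) j
      & phi (nth 1%g xs j) = elem i0 k (-1)].
Proof.
move=> jM mujc; have [ub memb] := bs_enum; set x := nth 1%g xs j.
have zb : nseq (size xs) 0%N \in bs.
  apply/memb; rewrite size_nseq; split=> //; rewrite /wdeg big1 // => i _.
  by rewrite nth_nseq if_same.
have eb : unit_exponent (size xs) j \in bs.
  by apply/memb; rewrite size_unit_exponent // wdeg_unit_exponent // mujc.
have zd : (index (nseq (size xs) 0%N) bs < d)%N by rewrite index_mem.
have ed : (index (unit_exponent (size xs) j) bs < d)%N by rewrite index_mem.
pose i0 := Ordinal zd; pose k0 := Ordinal ed.
have bi0 : nth [::] bs i0 = nseq (size xs) 0%N by rewrite /= nth_index.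
have bk0 : nth [::] bs k0 = unit_exponent (size xs) j by rewrite /= nth_index.
exists i0, k0; split=> //.
have pol1_cst f : polG 1 f -> forall g, f g = f 1%g.
  move=> pf g; have := pol_rdiff I (iso1 g) pf; rewrite subnn => /pol0 /(_ 1%g I).
  by rewrite /rdiff mul1g => /eqP; rewrite subr_eq0 => /eqP.
(* The function dual to the basis element [1] has degree 0, hence is constant, and pairing with a
   constant computes the augmentation. *)
have aug_b (i : 'I_d) : rg_aug (b i) = (i == i0)%:R.
  have [f [e [pf e0 cf]]] := dual_coords i0.
  have {}pf : polG 1 f.
    move: pf; rewrite bi0 /wdeg big1 // => l _; by rewrite nth_nseq if_same mul0n.
  have pb (l : 'I_d) : rg_aug (b l) * f 1%g = e * (l == i0)%:R.
    rewrite -pair_cst -(eq_pair (f := f)); last exact: pol1_cst.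
    by move/matrixP/(_ l 0): cf; rewrite !mxE eqxx andbT.
  have f1 : f 1%g = e.
    have := pb i0; rewrite eqxx mulr1 -pair_cst => <-.
    by rewrite bi0 pair_basis_elt0.
  by apply: (mulIf e0); rewrite -{1}f1 pb mulrC.
apply: toR_inj; apply/matrixP => i k.
have [f [e [pf e0 cf]]] := dual_coords k.
have wk : (wdeg mu (nth [::] bs k) <= c)%N by exact: wdeg_bs.
have pcf : polG c.+1 f by apply: pol_le pf.
have Fx : isolator c x by rewrite -mujc; case: (mu_spec jM).
have rc g : rdiff x f g = rdiff x f 1%g.
  apply: pol1_cst; apply: (pol_le _ (pol_rdiff I Fx pf)); lia.
have := toR_phi_sub1_coords x pcf; rewrite cf -scalemxAr => /matrixP /(_ i 0).
rewrite -colE !mxE (eq_pair _ rc) pair_cst aug_b /rdiff mul1g.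
have -> : f x - f 1%g = - (e * (k0 == k)%:R).
  rewrite -[LHS]opprB -(pair_basis_elt1 f jM) -bk0; congr (- _).
  by move/matrixP/(_ k0 0): cf; rewrite !mxE eqxx andbT.
move=> E; apply: (mulfI e0); rewrite -[LHS](subrK (e * ((i == k)%:R : int)%:~R)) -mulrBr.
move: E; rewrite intrB => ->.
rewrite intrD intrM [k == _]eq_sym -mulnb; case: (i == k); case: (i == i0); case: (k0 == k) => /=.
all: by rewrite /= ?intrD ?intrM; ring.
Qed.

End Representation.

(** * Two Mal'cev generators of top weight *)

Section Rank.
Variable gT : groupType.
Local Open Scope group_scope.

Lemma zexpgM (x : gT) (a b : int) : zexpg (zexpg x a) b = zexpg x (a * b)%R.
Proof.
elim/int_ind: b => [|n IHn|n IHn].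
- by rewrite mulr0.
- have -> : (n.+1%:Z = n%:Z + 1)%R by lia.
  by rewrite mulrDr mulr1 zexpgS IHn zexpgD.
have E : (- n%:Z = - n.+1%:Z + 1)%R by lia.
by move: IHn; rewrite E mulrDr mulr1 zexpgS zexpgD => /mulIg.
Qed.

(** If [b1 = x^p] and [b2 = x^q], then [b1^q = b2^p]; uniqueness of exponents gives [p = q = 0], so
    [b1] is trivial, which contradicts uniqueness again. *)
Lemma rank2_not_cyclic (P : gT -> Prop) (x : gT) : rank_at_least P 2 ->
  ~ (forall g, P g -> exists a, g = zexpg x a).
Proof.
case=> B [[PB [_ uniqB]]]; case: B PB uniqB => [|b1 [|b2 B]] // PB uniqB _ cyc.
have [p Ep] : exists a, b1 = zexpg x a by apply/cyc/PB; rewrite mem_head.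
have [q Eq] : exists a, b2 = zexpg x a by apply/cyc/PB; rewrite !inE eqxx orbT.
pose z := nseq (size B) 0%R : seq int.
have prod_z : \prod_(u <- zip B z) zexpg u.1 u.2 = 1.
  rewrite /z; elim: (B) => [|y B' IH] /=; first by rewrite big_nil.
  by rewrite big_cons IH mulg1.
have sz (r s : int) : size [:: r, s & z] = size [:: b1, b2 & B] by rewrite /= size_nseq.
have eqz (r s r' s' : int) :
    zexpg b1 r * zexpg b2 s = zexpg b1 r' * zexpg b2 s' -> [:: r, s & z] = [:: r', s' & z].
  by move=> E; apply: uniqB; rewrite ?sz // /= !big_cons prod_z /= !mulgA E.
have [q0 p0] : q = 0%R /\ p = 0%R.
  have /eqz [-> <-] // : zexpg b1 q * zexpg b2 0 = zexpg b1 0 * zexpg b2 p.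
  by rewrite Ep Eq !zexpgM !mulr0 mulg1 mul1g mulrC.
have /eqz [] // : zexpg b1 1 * zexpg b2 0 = zexpg b1 0 * zexpg b2 0.
by rewrite Ep p0.
Qed.

(** The isolator of [Gamma_c] is a term [subG xs i], and all generators from [i] on have weight [c].
    With fewer than two of them [Gamma_c] would lie in a cyclic group. *)
Lemma two_top_generators (c : nat) (xs : seq gT) mu :
    torsion_free gT -> (forall g : gT, lcs c.+1 g -> g = 1) ->
    malcev_basis c xs -> weight_spec xs mu -> rank_at_least (@lcs gT c) 2 ->
  exists j1 j2, [/\ (j1 < j2)%N, (j2 < size xs)%N, mu j1 = c & mu j2 = c].
Proof.
move=> tfG nilG malcev mu_spec rk.
have [i Hi] := isolator_subG tfG nilG malcev c.
have top j : (i <= j < size xs)%N -> mu j = c.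
  move=> /andP[ij jM]; have xjc : isolator c xs`_j by apply/Hi/subG_nth; rewrite ij.
  have [xj1 xj2] := mu_spec j jM.
  apply/eqP; rewrite eqn_leq; apply/andP; split; rewrite leqNgt; apply/negP => lt.
    have := isolator_trivial tfG nilG lt xj1 => x1.
    apply: (subG_nth_notin malcev jM); rewrite x1; exact: gen1.
  by apply: xj2; apply: isolator_le xjc.
have [le|lt] := leqP (size xs) i.+1; last first.
  by exists i, i.+1; split=> //; apply: top; lia.
case: (@rank2_not_cyclic (@lcs gT c) xs`_i rk) => g /isolator_lcs /Hi.
elim=> [|_ [j [ijM ->]]|y _ [a ->]|y z _ [a ->] _ [b' ->]].
- by exists 0%R.
- by exists 1%R; have -> : j = i by lia.
- by exists (- a)%R; rewrite zexpgN.
- by exists (a + b')%R; rewrite zexpgD.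
Qed.

End Rank.

(** * Comparison of growth rates and the contradiction *)

Lemma expn_lt_growth (c D K : nat) : (c < D)%N ->
  exists N : nat, ((1 + N * K) ^ c < N ^ D)%N.
Proof.
(* As [1 + N * K <= K1 * N], the left side is at most [K1 ^ c * N ^ c], so any [N] above [K1 ^ c]
   works. *)
move=> cD; pose K1 := K.+1; exists (K1 ^ c).+1; set N := (K1 ^ c).+1.
apply: (@leq_ltn_trans (K1 ^ c * N ^ c)%N).
  rewrite -expnMn; case: (c) => // c'; rewrite leq_exp2r // /K1; lia.
apply: (@leq_trans (N ^ c.+1)%N); last by rewrite leq_exp2l; lia.
by rewrite expnS ltn_mul2r expn_gt0 /=.
Qed.

Theorem theorem4p3 :
  forall (gT : groupType) (c : nat),
    tau_group gT ->
    nilpotent_of_class gT c ->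
    rank_at_least (@lcs gT c) 2 ->
    forall (R : fieldType), [pchar R]%R =i pred0 ->
    forall (xs : seq gT), malcev_basis c xs ->
    forall (mu : nat -> nat), weight_spec xs mu ->
    forall (bs : seq (seq nat)) (d : nat),
      basis_enum (size xs) c mu bs -> size bs = d ->
    forall (phi : gT -> 'M[int]_d),
      jennings_rep R c xs bs phi ->
      (forall g, unitriangular (phi g)) ->
    forall (S T : seq 'M[int]_d),
      generates_image phi S -> generates_UT T ->
      ~ undistorted phi S T.
Proof.
move=> gT c [_ [tfG _]] [nilG _] rk R charR xs malcev mu mu_spec bs _ bs_enum <-.
move=> phi phi_rep phiUT S T genS genT [C undist].
have gen := phi_generator tfG nilG malcev mu_spec charR bs_enum phi_rep.
have phiM' := phiM tfG nilG malcev mu_spec charR bs_enum phi_rep.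
have phi1' := phi1 tfG nilG malcev mu_spec charR bs_enum phi_rep.
have phiX j (i k : 'I_(size bs)) : i != k -> phi (nth 1%g xs j) = elem i k (-1) ->
    forall n : nat, phi (nth 1%g xs j ^+ n)%g = elem i k (- n%:Z)%R.
  move=> ik E; elim=> [|n IHn]; first by rewrite phi1' oppr0 elem0.
  by rewrite expgSr phiM' IHn E elemD //; congr elem; lia.
(* Some power [x^n] with [n > 0] lies in [Gamma_c]; its matrix has the nonzero entry [-n] at
   [(i, k)], so the band condition puts [k] at distance at least [c] from [i]. *)
have far j (i k : 'I_(size bs)) : (j < size xs)%N -> mu j = c ->
    phi (nth 1%g xs j) = elem i k (-1) -> i != k -> (i + c <= k)%N.
  move=> jM mujc E ik; have [[n [n0 xn]] _] := mu_spec j jM.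
  rewrite mujc in xn; rewrite leqNgt; apply/negP => ki.
  have := phi_lcs_band tfG nilG malcev mu_spec charR bs_enum phi_rep phiUT xn ki.
  by rewrite (phiX j i k ik E) !mxE !eqxx (negPf ik) /=; lia.
have [j [i [k [jM mujc E ik]]]] : exists j (i k : 'I_(size bs)),
    [/\ (j < size xs)%N, mu j = c, phi (nth 1%g xs j) = elem i k (-1) & (i + c < k)%N].
  (* Both generators share the row of the basis element [1] and have distinct columns, so at most
     one column lies at distance exactly [c]. *)
  have [j1 [j2 [j12 j2M m1 m2]]] := two_top_generators tfG nilG malcev mu_spec rk.
  have j1M : (j1 < size xs)%N by lia.
  have [i [k1 [bi bk1 E1]]] := gen j1 j1M m1.
  have [i' [k2 [bi' bk2 E2]]] := gen j2 j2M m2.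
  have ii' : i' = i.
    by apply/val_inj/eqP; rewrite -(nth_uniq [::] (ltn_ord i') (ltn_ord i) bs_enum.1) bi bi'.
  subst i'.
  have neq (k : 'I_(size bs)) j : nth [::] bs k = unit_exponent (size xs) j -> i != k.
    move=> bk; apply/eqP => ik; have := mem_nseq (size xs) 0%N 1%N.
    by rewrite -bi ik bk mem_cat mem_head orbT andbF.
  have k12 : (k1 != k2 :> nat).
    apply/eqP => k12; move: bk2; rewrite -k12 bk1 => /unit_exponent_inj; lia.
  have f1 := far j1 i k1 j1M m1 E1 (neq _ _ bk1).
  have f2 := far j2 i k2 j2M m2 E2 (neq _ _ bk2).
  have [lt|le] := ltnP (i + c) k1; first by exists j1, i, k1.
  by exists j2, i, k2; split=> //; lia.
have ik' : (i < k)%N by lia.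
have nik : i != k by rewrite -val_eqE /=; lia.
have [C1 HC1] := elem_wlen genT ik'.
have [B HB] := phi_entry_growth tfG nilG malcev mu_spec charR bs_enum phi_rep genS.
have cD : (c < k - i)%N by lia.
(* The power [x^(N^(k-i))] has length at most [C1 * N] in the unitriangular group, hence
   [C * C1 * N] in the image, which bounds its entries by [(1 + C * C1 * N * B)^c]; but one of them
   is [-N^(k-i)]. *)
have [N HN] := expn_lt_growth (C * C1 * B) cD.
have := HC1 N true; rewrite expr1 mulN1r -(phiX j i k nik E).
move/undist/HB => /(_ i k); rewrite (phiX j i k nik E) !mxE !eqxx (negPf nik) /=.
rewrite add0r mulr1 abszN absz_nat leqNgt.
suff -> : (C * (C1 * N) * B = N * (C * C1 * B))%N by rewrite HN.
by ring.
Qed.
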